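(* Let $n\ge1$, $\alpha=(\alpha_1,\dots,\alpha_n)\in(0,2]^n$, $\beta=(\beta_1,\dots,\beta_n)\in(0,\infty)^n$, and let $X^{\#}_{\alpha,\beta}(t)$, $t\in\mathbb{R}^n$, be the Gaussian sheet with generalized Cauchy covariance (GSGCC), i.e. the centered Gaussian field with covariance $\prod_{i=1}^n(1+|\tau_i|^{\alpha_i})^{-\beta_i}$. Assume that $\alpha_1=\dots=\alpha_{m_\alpha}<\alpha_{m_\alpha+1}\le\dots\le\alpha_n$ for some $m_\alpha\in\{1,\dots,n\}$, so that $\alpha_1=\dots=\alpha_{m_\alpha}=\min\alpha:=\min\{\alpha_1,\dots,\alpha_n\}$. Then $X^{\#}_{\alpha,\beta}$ is locally asymptotically self-similar (lass) with tangent field $T_{\alpha,\beta}$, which is a stationary centered Gaussian field with covariance $$\left\langle T_{\alpha,\beta}(u)T_{\alpha,\beta}(v)\right\rangle=\sum_{i=1}^{m_\alpha}\beta_i\left(|u_i|^{\min\alpha}+|v_i|^{\min\alpha}-|u_i-v_i|^{\min\alpha}\right).$$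
   Context: $\langle\cdot\rangle$ denotes expectation. The GSGCC is the centered Gaussian field with $\langle X^{\#}_{\alpha,\beta}(t+\tau)X^{\#}_{\alpha,\beta}(t)\rangle=\prod_{i=1}^n(1+|\tau_i|^{\alpha_i})^{-\beta_i}$ for $t,\tau\in\mathbb{R}^n$. A random field $X(t)$ is lass at a point $t_0$ with order $\kappa$ if, as $\varepsilon\to0^+$, $\{\varepsilon^{-\kappa}(X(t_0+\varepsilon u)-X(t_0))\}_{u\in\mathbb{R}^n}$ converges in the sense of finite-dimensional distributions to a nontrivial field $T_{t_0}(u)$, called the tangent field of $X$ at $t_0$; it is called lass when this holds for some order $\kappa$.
   Formalization: ''Stationary'' for the tangent field is replaced by ''with stationary increments'': the stated covariance gives variance 0 at u = 0 and 2β_1 > 0 at the first unit vector, so the field is never stationary. *)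

(* Defs.v *)
From HB Require Import structures.
From mathcomp Require Export all_boot all_order all_algebra.
From mathcomp Require Export all_classical all_reals all_analysis.

Set Implicit Arguments.
Unset Strict Implicit.
Unset Printing Implicit Defensive.

Export Order.TTheory GRing.Theory Num.Theory numFieldNormedType.Exports.

Local Open Scope classical_set_scope.
Local Open Scope ring_scope.

(* [normal_prob m 0] is the uniform law on [0, 1] in the library; the law
   N(m, 0) has to be the Dirac mass at m. *)
Definition gaussian_law (R : realType) (m s : R)
    (A : set (measurableTypeR R)) : \bar R :=
  if s == 0 then \d_m A else normal_prob m s A.

(* Every finite linear combination has a (possibly degenerate) normal law. *)
Definition gaussian_field (R : realType) (n : nat) (d : measure_display)
    (Omega : measurableType d) (P : probability Omega R)
    (X : 'rV[R]_n -> {RV P >-> R}) : Prop :=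
  forall (k : nat) (t : 'I_k -> 'rV[R]_n) (c : 'I_k -> R),
    exists m s : R, forall A : set (measurableTypeR R), measurable A ->
      P ((fun w => \sum_(j < k) c j * X (t j) w) @^-1` A) = gaussian_law m s A.

Definition centered_gaussian_field (R : realType) (n : nat)
    (d : measure_display) (Omega : measurableType d) (P : probability Omega R)
    (X : 'rV[R]_n -> {RV P >-> R}) : Prop :=
  gaussian_field X /\ (forall t, 'E_P[X t]%E = 0%E).

Definition gsgcc (R : realType) (n : nat) (alpha beta : 'I_n -> R)
    (d : measure_display) (Omega : measurableType d) (P : probability Omega R)
    (X : 'rV[R]_n -> {RV P >-> R}) : Prop :=
  centered_gaussian_field X /\
  (forall t tau : 'rV[R]_n,
     'E_P[fun w => (X (t + tau) w * X t w)%R]%E =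
     (\prod_(i < n)
        (1 + `|tau ord0 i| `^ alpha i) `^ (- beta i))%:E).

Definition fd_vector (R : realType) (n : nat) (Omega : Type)
    (Y : 'rV[R]_n -> Omega -> R) (k : nat) (u : 'I_k -> 'rV[R]_n)
    (w : Omega) : 'rV[R]_k :=
  \row_(j < k) Y (u j) w.

(* Convergence in law of all finite-dimensional vectors, for a family of
   fields indexed by eps > 0. *)
Definition cvg_fdd (R : realType) (n : nat)
    (d : measure_display) (Omega : measurableType d) (P : probability Omega R)
    (Y : R -> 'rV[R]_n -> Omega -> R)
    (d' : measure_display) (Omega' : measurableType d')
    (P' : probability Omega' R) (T : 'rV[R]_n -> Omega' -> R) : Prop :=
  forall (k : nat) (u : 'I_k -> 'rV[R]_n) (f : 'rV[R]_k -> R),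
    continuous f -> (exists M : R, forall x, `|f x| <= M) ->
    'E_P[fun w => (f (fd_vector (Y eps) u w))%R]%E @[eps --> 0^'+] -->
    'E_P'[fun w => (f (fd_vector T u w))%R]%E.

(* Equality of the finite-dimensional laws, on the Borel sets of R^k. *)
Definition eq_fdd (R : realType) (n : nat)
    (d : measure_display) (Omega : measurableType d) (P : probability Omega R)
    (Y : 'rV[R]_n -> Omega -> R)
    (d' : measure_display) (Omega' : measurableType d')
    (P' : probability Omega' R) (Z : 'rV[R]_n -> Omega' -> R) : Prop :=
  forall (k : nat) (u : 'I_k -> 'rV[R]_n) (A : set 'rV[R]_k),
    <<s [set B : set 'rV[R]_k | open B] >> A ->
    P (fd_vector Y u @^-1` A) = P' (fd_vector Z u @^-1` A).

Definition stationary_increments (R : realType) (n : nat)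
    (d : measure_display) (Omega : measurableType d) (P : probability Omega R)
    (T : 'rV[R]_n -> {RV P >-> R}) : Prop :=
  forall h : 'rV[R]_n,
    eq_fdd P (fun u w => T (u + h) w - T h w) P (fun u w => T u w - T 0 w).

Definition nontrivial_field (R : realType) (n : nat)
    (d : measure_display) (Omega : measurableType d) (P : probability Omega R)
    (T : 'rV[R]_n -> {RV P >-> R}) : Prop :=
  exists u : 'rV[R]_n, ~ {ae P, forall w, T u w = 0}.

Definition lass_at (R : realType) (n : nat)
    (d : measure_display) (Omega : measurableType d) (P : probability Omega R)
    (X : 'rV[R]_n -> {RV P >-> R}) (t0 : 'rV[R]_n) (kappa : R)
    (d' : measure_display) (Omega' : measurableType d')
    (P' : probability Omega' R) (T : 'rV[R]_n -> {RV P' >-> R}) : Prop :=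
  cvg_fdd P
    (fun eps u w => eps `^ (- kappa) * (X (t0 + eps *: u) w - X t0 w)) P' T /\
  nontrivial_field T.

(* The same order and the same tangent field at every point. *)
Definition lass_with_tangent (R : realType) (n : nat)
    (d : measure_display) (Omega : measurableType d) (P : probability Omega R)
    (X : 'rV[R]_n -> {RV P >-> R})
    (d' : measure_display) (Omega' : measurableType d')
    (P' : probability Omega' R) (T : 'rV[R]_n -> {RV P' >-> R}) : Prop :=
  exists kappa : R, forall t0 : 'rV[R]_n, lass_at X t0 kappa T.

Definition min_coord (R : realType) (n : nat) (hn : (0 < n)%N)
    (alpha : 'I_n -> R) : R :=
  \big[Num.min/alpha (Ordinal hn)]_(i < n) alpha i.

(* Main.v *)
Require Import Defs.
From HB Require Import structures.
From mathcomp Require Import ring lra measurable_realfun.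

(** The linear span H of the values of X is a space of centered Gaussian
    variables, whose laws depend only on their variances, and as the covariance
    vanishes at infinity H contains an orthonormal sequence (xi_j).  With
    a = min alpha, (1 - C(eps u)) / eps^a tends to
    V(u) = sum_(i < m) beta_i |u_i|^a, so the covariances of the increments
    rescaled by eps^(-a/2) tend to K(u, v) = V(u) + V(v) - V(u - v).  This limit
    kernel is positive semidefinite and separable; Gram-Schmidt along a countable
    dense set gives K(u, v) = sum_j f_j(u) f_j(v), and T(u) = sum_j f_j(u) xi_j,
    converging almost surely along a fast subsequence, is a Gaussian field with
    covariance K on the same probability space.  Linear combinations of the
    rescaled increments converge in law to those of T because their variances
    do.  Joint convergence follows by approximating a bounded continuous f by
    trigonometric polynomials p with |f - p| <= eta (1 + sum_i |x_i|), which are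
    the Bernstein polynomials of f in the variables sin (x_i / M). *)

Set Implicit Arguments.
Unset Strict Implicit.
Unset Printing Implicit Defensive.

Local Open Scope classical_set_scope.
Local Open Scope ring_scope.

(** * Affine images of normal laws *)

(** The variances of the increments are of order eps^a, whence the order a / 2. Since K(0, 0) = 0,
    the tangent field vanishes almost surely at the origin while its variance 2 V(u) is not
    constant, so stationarity can only be that of its increments. The hypotheses give normal laws
    with unspecified parameters, and T, being an almost sure limit, may leave H. One fixed element
    xi of H of variance 1 deals with both difficulties: an element of H of variance v has the law of
    sqrt(v) xi, so convergence of the variances becomes convergence of sqrt(v) xi at every sample
    point, and dominated convergence applies. Neither the moments nor the characteristic function of
    a normal law are ever computed; affine images of normal laws are all that is required. The
    factor 1 + sum_i |x_i| in the approximation error stands in for tightness: first moments are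
    bounded through the variances, uniformly for small eps. *)

Lemma normal_pdf_affine (R : realType) (m s a b x : R) : s != 0 -> 0 < b ->
  normal_pdf (a + b * m) (b * s) (a + b * x) * b = normal_pdf m s x.
Proof.
move=> s0 b0; have bn : b != 0 by rewrite gt_eqF.
rewrite !normal_pdfE ?mulf_neq0// mulrAC; congr (_ * _).
  rewrite /normal_peak exprMn -mulrA -mulrnAr sqrtrM ?sqr_ge0//.
  by rewrite sqrtr_sqr gtr0_norm// invfM mulrAC mulVf// mul1r.
rewrite /normal_fun; congr expR.
by field; rewrite bn s0.
Qed.

(** Closed half-lines form a pi-system that generates the Borel sets, so the change of variables is
    needed on them only. *)
Lemma normal_prob_affine_ray (R : realType) (m s a b r : R) :
  s != 0 -> 0 < b ->
  normal_prob (a + b * m) (b * s) `[a + b * r, +oo[ = normal_prob m s `[r, +oo[.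
Proof.
move=> s0 b0; rewrite /normal_prob.
pose F (x : R^o) : R^o := a + b * x.
have dF (x : R^o) : is_derive x (1 : R^o) F b.
  rewrite /F; apply: is_derive_eq.
  by rewrite add0r mul1r /GRing.scale /= mulr1.
have F'E : F^`()%classic = cst b.
  by apply/funext => x; rewrite derive1E derive_val.
rewrite -[a + b * r]/(F r) increasing_ge0_integration_by_substitutiony.
- apply: eq_integral => x _; congr EFin.
  by rewrite F'E /= -[RHS](normal_pdf_affine m a x s0 b0).
- by move=> x y _ _ xy; rewrite /F ltrD2l ltr_pM2l.
- by rewrite F'E => ? _; exact: cvg_cst.
- by rewrite F'E; exact: is_cvg_cst.
- by rewrite F'E; exact: is_cvg_cst.
- split=> [x _ //|]; apply: cvg_at_right_filter.
  by apply/differentiable_continuous; rewrite -derivable1_diffP.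
- rewrite /F; apply: (cvg_comp (fun x => b * x) (fun y => a + y)); last exact: cvg_addrl.
  exact: gt0_cvgMry.
- apply: continuous_subspaceT.
  by apply: continuous_normal_pdf; rewrite mulf_neq0// gt_eqF.
- by move=> x _; exact: normal_pdf_ge0.
Qed.

Lemma normal_prob_affine (R : realType) (m s a b : R)
    (A : set (measurableTypeR R)) :
  s != 0 -> 0 < b -> measurable A ->
  normal_prob (a + b * m) (b * s) A =
  normal_prob m s ((fun x => a + b * x) @^-1` A).
Proof.
move=> s0 b0 mA.
have mF : @measurable_fun _ _ (measurableTypeR R) (measurableTypeR R) setT
    (fun x => a + b * x).
  by apply: measurable_funD => //; exact: measurable_funM.
pose F : {mfun measurableTypeR R >-> measurableTypeR R} :=
  HB.pack (fun x : R => a + b * x) (isMeasurableFun.Build _ _ _ _ _ mF).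
pose m1 : {measure set (measurableTypeR R) -> \bar R} :=
  normal_prob (a + b * m) (b * s).
pose m2 : {measure set (measurableTypeR R) -> \bar R} :=
  distribution (normal_prob m s) F.
change (m1 A = m2 A).
apply: (@g_sigma_algebra_measure_unique _ R (measurableTypeR R) (@RGenCInfty.G R) _
  (fun n => `[- n%:R, +oo[%classic) _ _ m1 m2).
- by move=> _ [x ->]; exact: measurable_itv.
- by move=> n; exists (- n%:R).
- apply/seteqP; split=> // x _; exists (Num.truncn `|x|).+1 => //=.
  rewrite in_itv/= andbT lerNl (le_trans (ler_norm _))// normrN.
  exact/ltW/truncnS_gt.
- move=> _ _ [x ->] [y ->]; exists (Num.max x y).
  by apply/seteqP; split=> z/=; rewrite !in_itv/= !andbT ge_max => /andP.
- move=> _ [x ->]; have -> : x = a + b * ((x - a) / b).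
    by field; rewrite gt_eqF.
  rewrite /m1 /m2 /= [LHS]normal_prob_affine_ray//; congr normal_prob.
  by apply/seteqP; split=> z/=; rewrite !in_itv/= !andbT lerD2l ler_pM2l.
- by move=> k; rewrite (le_lt_trans (probability_le1 _ _)) ?ltry.
- suff -> : <<s @RGenCInfty.G R >> = (@ocitv R).-sigma.-measurable by exact: mA.
  by rewrite RGenCInfty.measurableE.
Qed.

(** * Spaces of centered Gaussian variables *)

Definition eq_law (R : realType) d (Omega : measurableType d)
    (P : probability Omega R) (U V : Omega -> R) : Prop :=
  forall A : set (measurableTypeR R), measurable A ->
    P (U @^-1` A) = P (V @^-1` A).

Definition square_integrable (R : realType) d (Omega : measurableType d)
    (P : probability Omega R) (U : Omega -> R) : Prop :=
  measurable_fun setT U /\ P.-integrable setT (fun w => (U w ^+ 2)%:E).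

(** For nonnegative g both sides are integrals against the distributions; splitting g into positive
    and negative parts then avoids any integrability assumption. *)
Lemma eq_law_integral (R : realType) d (Omega : measurableType d)
    (P : probability Omega R) (U V : Omega -> R) (g : R -> \bar R) :
  measurable_fun setT U -> measurable_fun setT V -> eq_law P U V ->
  measurable_fun setT g ->
  (\int[P]_w g (U w) = \int[P]_w g (V w))%E.
Proof.
move=> mU mV UV mg.
pose U' : {RV P >-> R} := mfun_Sub (mem_set mU).
pose V' : {RV P >-> R} := mfun_Sub (mem_set mV).
have pos (h : R -> \bar R) : measurable_fun setT h -> (forall x, 0 <= h x)%E ->
    (\int[P]_w h (U w) = \int[P]_w h (V w))%E.
  move=> mh h0.
  have -> : (\int[P]_w h (U w) = \int[distribution P U']_x h x)%E.
    by rewrite ge0_integral_distribution.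
  have -> : (\int[P]_w h (V w) = \int[distribution P V']_x h x)%E.
    by rewrite ge0_integral_distribution.
  by apply: eq_measure_integral => A mA _; exact: UV.
have ep (W : Omega -> R) : (fun w => g (W w))^\+%E = (fun w => g^\+%E (W w)).
  by apply/funext => w; rewrite !funeposE.
have en (W : Omega -> R) : (fun w => g (W w))^\-%E = (fun w => g^\-%E (W w)).
  by apply/funext => w; rewrite !funenegE.
rewrite integralE [RHS]integralE !ep !en; congr (_ - _)%E.
  exact: (pos (g^\+)%E (measurable_funepos mg) (funepos_ge0 g)).
exact: (pos (g^\-)%E (measurable_funeneg mg) (funeneg_ge0 g)).
Qed.

Lemma eq_law_Rintegral (R : realType) d (Omega : measurableType d)
    (P : probability Omega R) (U V : Omega -> R) (g : R -> R) :
  measurable_fun setT U -> measurable_fun setT V -> eq_law P U V ->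
  measurable_fun setT g ->
  \int[P]_w g (U w) = \int[P]_w g (V w).
Proof.
move=> mU mV UV mg; congr fine.
by apply: (@eq_law_integral _ _ _ _ _ _ (EFin \o g)) => //; exact/measurable_EFinP.
Qed.

Lemma square_integrableM (R : realType) d (Omega : measurableType d)
    (P : probability Omega R) (U V : Omega -> R) :
  square_integrable P U -> square_integrable P V ->
  P.-integrable setT (fun w => (U w * V w)%:E).
Proof.
move=> [mU iU] [mV iV].
apply: (le_integrable _ _ _ (integrableD _ iU iV)) => //.
  by apply/measurable_EFinP; exact: measurable_funM.
move=> w _; rewrite lee_fin.
rewrite [leRHS]ger0_norm ?addr_ge0 ?sqr_ge0// normrM.
rewrite -(real_normK (num_real (U w))) -(real_normK (num_real (V w))).
have := sqr_ge0 (`|U w| - `|V w|); have := normr_ge0 (U w).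
have := normr_ge0 (V w); nra.
Qed.

Lemma square_integrable_cst (R : realType) d (Omega : measurableType d)
    (P : probability Omega R) (a : R) : square_integrable P (cst a).
Proof.
split; first exact: measurable_cst.
exact: (finite_measure_integrable_cst P (a ^+ 2)).
Qed.

Lemma square_integrable_integrable (R : realType) d (Omega : measurableType d)
    (P : probability Omega R) (U : Omega -> R) :
  square_integrable P U -> P.-integrable setT (fun w => (U w)%:E).
Proof.
move=> iU; have := square_integrableM iU (square_integrable_cst P 1).
by under eq_fun do rewrite mulr1.
Qed.

Lemma square_integrable_lin (R : realType) d (Omega : measurableType d)
    (P : probability Omega R) (a : R) (U V : Omega -> R) :
  square_integrable P U -> square_integrable P V ->
  square_integrable P (fun w => a * U w + V w).
Proof.
move=> sU sV; have iUV := square_integrableM sU sV.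
move: sU sV => [mU iU] [mV iV]; split.
  by apply: measurable_funD => //; exact: measurable_funM.
rewrite [X in integrable _ _ X](_ : _ = (fun w =>
  (a ^+ 2)%:E * (U w ^+ 2)%:E + ((a *+ 2)%:E * (U w * V w)%:E + (V w ^+ 2)%:E))%E).
  apply: integrableD => //; first exact: integrableZl.
  by apply: integrableD => //; exact: integrableZl.
by apply/funext => w; rewrite -!EFinM -!EFinD; congr EFin; ring.
Qed.

Lemma Rintegral_sqr_eq0 (R : realType) d (Omega : measurableType d)
    (P : probability Omega R) (U : Omega -> R) :
  square_integrable P U -> \int[P]_w (U w ^+ 2) = 0 ->
  {ae P, forall w, U w = 0}.
Proof.
move=> [mU iU] U0.
have : (\int[P]_w `|(U w ^+ 2)%:E| = 0)%E.
  under eq_integral do rewrite gee0_abs ?lee_fin ?sqr_ge0//.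
  by rewrite -[LHS]fineK ?integrable_fin_num//; congr EFin.
move/(ae_eq_integral_abs P measurableT (measurable_int _ iU)).
by apply: filterS => w /(_ I) [] /eqP; rewrite sqrf_eq0 => /eqP.
Qed.

Lemma ae_cst_law (R : realType) d (Omega : measurableType d)
    (P : probability Omega R) (U : Omega -> R) (a : R) (A : set (measurableTypeR R)) :
  measurable_fun setT U -> measurable A -> {ae P, forall w, U w = a} ->
  P (U @^-1` A) = \d_a A.
Proof.
move=> mU mA Ua.
have mUA : measurable (U @^-1` A) by rewrite -[X in measurable X]setTI; exact: mU.
have <- : (\int[P]_w (\1_(U @^-1` A) w)%:E = P (U @^-1` A))%E.
  by rewrite integral_indic// setIT.
rewrite (@ae_eq_integral _ _ _ P setT (cst (\1_A a)%:E))//.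
- rewrite integral_cst//= probability_setT mule1.
  by rewrite diracE indicE.
- by apply/measurable_EFinP; exact: measurable_indic.
- by apply: filterS Ua => w Uw _; rewrite /= !indicE -Uw; congr (_%:R%:E); apply/idP/idP; rewrite !inE.
Qed.

(** The scale provided by [gaussian_law] may be negative; the density depends on it through s^2
    only. *)
Lemma normal_prob_norm (R : realType) (m s : R) :
  normal_prob m `|s| = normal_prob m s.
Proof.
apply/funext => A; rewrite /normal_prob.
suff -> : normal_pdf m `|s| = normal_pdf m s by [].
by rewrite /normal_pdf /normal_peak /normal_fun normr_eq0 real_normK ?num_real.
Qed.

(** Stable under finite linear combinations, not under limits: the variables T u, constructed later
    as almost sure limits, are therefore handled through their laws. *)
Definition gaussian_space (R : realType) d (Omega : measurableType d)
    (P : probability Omega R) (H : set (Omega -> R)) : Prop :=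
  [/\ H (cst 0),
      forall a U V, H U -> H V -> H (fun w => a * U w + V w),
      forall U, H U -> square_integrable P U,
      forall U, H U -> \int[P]_w U w = 0 &
      forall U, H U -> exists m s : R, forall A : set (measurableTypeR R),
        measurable A -> P (U @^-1` A) = gaussian_law m s A].

Lemma dirac_ae (R : realType) d (Omega : measurableType d)
    (P : probability Omega R) (U : Omega -> R) (a : R) :
  measurable_fun setT U -> P (U @^-1` [set a]) = 1%E ->
  {ae P, forall w, U w = a}.
Proof.
move=> mU Ua.
have mUa : measurable (U @^-1` [set a]).
  by rewrite -[X in measurable X]setTI; exact: mU.
exists (~` (U @^-1` [set a])); split => //; first exact: measurableC.
by rewrite probability_setC// Ua subee.
Qed.

(** With s = 0 the variable is almost surely m; its mean 0 forces m = 0, and its second moment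
    vanishes. *)
Lemma gaussian_space_nondegenerate (R : realType) d (Omega : measurableType d)
    (P : probability Omega R) (H : set (Omega -> R)) (U : Omega -> R) (m s : R) :
  gaussian_space P H -> H U -> \int[P]_w (U w ^+ 2) != 0 ->
  (forall A : set (measurableTypeR R), measurable A ->
     P (U @^-1` A) = gaussian_law m s A) ->
  s != 0.
Proof.
move=> [_ _ H2 H0 _] HU U20 Ulaw; apply: contra U20 => /eqP s0.
have [mU iU] := H2 _ HU.
have Um : {ae P, forall w, U w = m}.
  apply: dirac_ae => //; rewrite Ulaw; last exact: measurable_set1.
  by rewrite /gaussian_law s0 eqxx diracE mem_set.
have m0 : m = 0.
  rewrite -(H0 _ HU); apply/esym.
  rewrite /Rintegral (@ae_eq_integral _ _ _ P setT (cst m%:E))//.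
  - by rewrite integral_cst//= probability_setT mule1.
  - by apply/measurable_EFinP.
  - by apply: filterS Um => w -> _.
apply/eqP; rewrite /Rintegral (@ae_eq_integral _ _ _ P setT (cst 0%E))//.
- by rewrite integral_cst// mul0e.
- by apply/measurable_EFinP; exact: measurable_funX.
- by apply: filterS Um => w -> _; rewrite m0 expr0n.
Qed.

(** Any two nondegenerate normal laws are affine images of each other, so V has the law of a + b U
    with b > 0. Equal means give a = 0 and equal second moments give b = 1, without knowing the
    moments of a normal law. *)
Lemma gaussian_space_eq_law (R : realType) d (Omega : measurableType d)
    (P : probability Omega R) (H : set (Omega -> R)) (U V : Omega -> R) :
  gaussian_space P H -> H U -> H V ->
  \int[P]_w (U w ^+ 2) = \int[P]_w (V w ^+ 2) -> eq_law P U V.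
Proof.
move=> gH HU HV UV; have [_ _ H2 H0 Hlaw] := gH.
have [mU iU] := H2 _ HU; have [mV iV] := H2 _ HV.
move=> A mA.
have [U0|U0] := eqVneq (\int[P]_w (U w ^+ 2)) 0.
  rewrite (ae_cst_law mU mA (Rintegral_sqr_eq0 (H2 _ HU) U0)).
  by rewrite (ae_cst_law mV mA (Rintegral_sqr_eq0 (H2 _ HV) _))// -UV.
have [m [s Us]] := Hlaw _ HU; have [m' [s' Vs]] := Hlaw _ HV.
have s0 := gaussian_space_nondegenerate gH HU U0 Us.
rewrite UV in U0; have s'0 := gaussian_space_nondegenerate gH HV U0 Vs.
pose b := `|s'| / `|s|; pose a := m' - b * m.
have b0 : 0 < b by rewrite divr_gt0 ?normr_gt0.
have mf : measurable_fun setT (fun x : R => a + b * x).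
  by apply: measurable_funD => //; exact: measurable_funM.
have VW : eq_law P V (fun w => a + b * U w).
  move=> B mB; rewrite Vs//.
  have -> : (fun w => a + b * U w) @^-1` B =
            U @^-1` ((fun x => a + b * x) @^-1` B) by [].
  rewrite Us; last by rewrite -[X in measurable X]setTI; exact: mf.
  rewrite /gaussian_law (negbTE s0) (negbTE s'0).
  rewrite -(normal_prob_norm m s) -normal_prob_affine ?normr_eq0//.
  by rewrite /a subrK /b divfK ?normr_eq0// normal_prob_norm.
have mW : measurable_fun setT (fun w => a + b * U w).
  by apply: measurable_funD => //; exact: measurable_funM.
have iU1 := square_integrable_integrable (H2 _ HU).
have iW : P.-integrable setT (fun w => (b * U w)%:E).
  by under eq_fun do rewrite EFinM; exact: integrableZl.
have a0 : a = 0.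
  have := eq_law_Rintegral mV mW VW (@measurable_id _ _ setT).
  rewrite H0// RintegralD//; last first.
    exact: (finite_measure_integrable_cst P).
  rewrite RintegralZl// (H0 _ HU) mulr0 addr0 Rintegral_cst//= probability_setT/=.
  by rewrite mulr1.
have b1 : b = 1.
  have /(eq_law_Rintegral mV mW VW) : measurable_fun setT (fun x : R => x ^+ 2) by [].
  under [RHS]eq_Rintegral do rewrite a0 add0r exprMn.
  rewrite RintegralZl// UV => /(congr1 (fun x => x / \int[P]_w V w ^+ 2)).
  by rewrite mulfK// divff// => /esym/eqP; rewrite sqrp_eq1 ?(ltW b0)// => /eqP.
rewrite VW//; congr (P _).
by rewrite a0 b1; apply/seteqP; split => w /=; rewrite add0r mul1r.
Qed.

(** * Approximation by trigonometric polynomials *)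

(** Write sin a - sin b = 2 cos((a + b) / 2) sin((a - b) / 2). Confining a to [-1/2, 1/2] keeps (a +
    b) / 2 within r < pi / 2, where the cosine stays positive; it would degenerate with both points
    near the same end of [-pi/2, pi/2]. *)
Lemma sin_separation (R : realType) (delta : R) : 0 < delta <= 1 ->
  exists2 gamma : R, 0 < gamma & forall a b : R,
    `|a| <= 2^-1 -> `|b| <= pi / 2 -> delta <= `|a - b| ->
    gamma <= `|sin a - sin b|.
Proof.
move=> /andP[d0 d1]; have p1 := @pihalf_ge1 R.
pose r : R := (2^-1 + pi / 2) / 2.
have r0 : 0 < r by rewrite /r; lra.
have rpi : r < pi / 2 by rewrite /r; lra.
have cr0 : 0 < cos r by apply: cos_gt0_pihalf; rewrite rpi andbT; lra.
have sd0 : 0 < sin (delta / 2) by apply: sin_gt0_pihalf; apply/andP; split; lra.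
exists (2 * cos r * sin (delta / 2)); first by rewrite !mulr_gt0.
have key (a b : R) : `|a| <= 2^-1 -> `|b| <= pi / 2 -> delta <= a - b ->
    2 * cos r * sin (delta / 2) <= sin a - sin b.
  rewrite !ler_norml => /andP[a1 a2] /andP[b1 b2] dab.
  pose u := (a + b) / 2; pose h := (a - b) / 2.
  have -> : sin a - sin b = 2 * cos u * sin h.
    have -> : a = u + h by rewrite /u /h; field.
    have -> : b = u - h by rewrite /u /h; field.
    by rewrite sinD sinB /u /h; ring.
  have cu : cos r <= cos `|u|.
    have ur : `|u| <= r by rewrite ler_norml /u /r; apply/andP; split; lra.
    rewrite leNgt; apply/negP; rewrite ltr_cos ?in_itv/= ?normr_ge0/=; lra.
  have cuE : cos `|u| = cos u by case: (ger0P u) => // _; rewrite cosN.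
  have sh : sin (delta / 2) <= sin h.
    rewrite leNgt; apply/negP; rewrite ltr_sin ?in_itv/=; first by rewrite /h; lra.
      by rewrite /h; apply/andP; split; lra.
    by apply/andP; split; lra.
  rewrite cuE in cu; rewrite -!mulrA ler_pM2l//.
  by apply: ler_pM => //; exact: ltW.
move=> a b a1 b1 dab.
have [ab|ab] := lerP 0 (a - b).
  rewrite ger0_norm// in dab.
  by rewrite (le_trans (key _ _ a1 b1 dab))// ler_norm.
rewrite ltr0_norm// in dab.
have := key (- a) (- b); rewrite !normrN => /(_ a1 b1).
rewrite !sinN => /(_ _) /le_trans; apply; first lra.
by rewrite -[leRHS]normrN; apply: le_trans (ler_norm _); lra.
Qed.

(** Only x is confined to K: the Bernstein nodes that it is compared with may lie outside the
    box. *)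
Lemma compact_unif_near (R : realType) (V : pseudoMetricType R) (K : set V) (f : V -> R) (eta : R) :
  compact K -> continuous f -> 0 < eta ->
  exists2 delta : R, 0 < delta & forall x y, K x -> ball x delta y ->
    `|f x - f y| <= eta.
Proof.
move=> /compact_near_coveringP cK cf eta0.
have := cK R (0^'+) (fun e x => forall y, ball x e y -> `|f x - f y| <= eta) _.
case=> [x Kx|].
  have /cvgrPdist_lt/(_ (eta / 2)) := cf x.
  rewrite divr_gt0// => /(_ isT) /nbhs_ballP[r /= r0 hr].
  exists (ball x (r / 2), [set e | e < r / 2]) => /=.
    split; first by apply: nbhsx_ballx; rewrite divr_gt0.
    by apply: nbhs_right_lt; rewrite divr_gt0.
  move=> [z e] /= [xz er] y zy.
  have h1 : `|f x - f z| < eta / 2.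
    by apply: hr; apply: le_ball xz; rewrite ler_pdivrMr// ler_peMr// ?ler1n// ltW.
  have h2 : `|f x - f y| < eta / 2.
    apply: hr; rewrite [r]splitr; apply: ball_triangle xz _.
    by apply: le_ball zy; exact: ltW.
  have -> : f z - f y = - (f x - f z) + (f x - f y) by ring.
  by rewrite (le_trans (ler_normD _ _))// normrN; lra.
move=> D /= D0 hD; exists (D / 2); first by rewrite divr_gt0.
move=> x y Kx xy.
apply: (hD (D / 2)) => //=; last by rewrite divr_gt0.
rewrite /ball/= sub0r normrN gtr0_norm ?divr_gt0//.
by rewrite ltr_pdivrMr// ltr_pMr// ltr1n.
Qed.

(* Weights of the binomial law B(N, q), through Pascal's recursion. *)
Fixpoint bernstein (R : realType) (q : R) (N j : nat) : R :=
  if N is N'.+1 then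
    (1 - q) * bernstein q N' j + (if j is j'.+1 then q * bernstein q N' j' else 0)
  else (j == 0)%:R.

Lemma bernstein_ge0 (R : realType) (q : R) (N j : nat) :
  0 <= q <= 1 -> 0 <= bernstein q N j.
Proof.
move=> /andP[q0 q1]; elim: N j => [|N IH] [|j] //=.
  by rewrite addr0 mulr_ge0 ?subr_ge0.
by rewrite addr_ge0 ?mulr_ge0 ?subr_ge0.
Qed.

Lemma bernstein_gt (R : realType) (q : R) (N j : nat) :
  (N < j)%N -> bernstein q N j = 0.
Proof.
elim: N j => [|N IH] [|j] //= Nj.
by rewrite !IH ?mulr0 ?addr0// ltnW.
Qed.

(** Conditioning on one Bernoulli trial: a failure keeps j, a success shifts it by one. *)
Lemma sum_bernsteinS (R : realType) (q : R) (N : nat) (f : nat -> R) :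
  \sum_(j < N.+2) bernstein q N.+1 j * f j =
  (1 - q) * (\sum_(j < N.+1) bernstein q N j * f j) +
  q * (\sum_(j < N.+1) bernstein q N j * f j.+1).
Proof.
under eq_bigr do rewrite [bernstein _ _ _]/= mulrDl.
rewrite big_split/=; congr (_ + _).
  rewrite big_ord_recr/= bernstein_gt// mulr0 mul0r addr0 mulr_sumr.
  by apply: eq_bigr => j _; rewrite mulrA.
rewrite big_ord_recl/= mul0r add0r mulr_sumr.
by apply: eq_bigr => j _; rewrite mulrA.
Qed.

Lemma sum_bernstein (R : realType) (q : R) (N : nat) :
  \sum_(j < N.+1) bernstein q N j = 1.
Proof.
under eq_bigr do rewrite -[bernstein _ _ _]mulr1.
elim: N => [|N IH]; first by rewrite big_ord1 mulr1.
by rewrite (sum_bernsteinS q N (fun=> 1)) IH; ring.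
Qed.

(** The centre c is left free because a success moves it to c - 1 in the induction; c = N q gives
    the binomial variance. *)
Lemma sum_bernstein_sqr (R : realType) (q c : R) (N : nat) :
  \sum_(j < N.+1) bernstein q N j * (j%:R - c) ^+ 2 =
  (N%:R * q - c) ^+ 2 + N%:R * (q * (1 - q)).
Proof.
elim: N c => [|N IH] c; first by rewrite big_ord1/=; ring.
rewrite (sum_bernsteinS q N (fun j => (j%:R - c) ^+ 2)) IH.
under eq_bigr => j _.
  have -> : j.+1%:R - c = j%:R - (c - 1) :> R by rewrite -natr1; ring.
  over.
by rewrite IH -natr1; ring.
Qed.

(** The joint law of k independent binomial variables. *)
Definition bernstein_mx (R : realType) (k N : nat) (q : 'I_k -> R)
    (J : {ffun 'I_k -> 'I_N.+1}) : R :=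
  \prod_i bernstein (q i) N (J i).

Lemma sum_bernstein_mx (R : realType) (k N : nat) (q : 'I_k -> R) :
  \sum_(J : {ffun 'I_k -> 'I_N.+1}) bernstein_mx q J = 1.
Proof.
rewrite -(bigA_distr_bigA (fun i (j : 'I_N.+1) => bernstein (q i) N j)).
by apply: big1 => i _; exact: sum_bernstein.
Qed.

(** The marginal law of one coordinate: after distributing the product over the sum, every other
    factor is a total mass 1. *)
Lemma sum_bernstein_mx_coord (R : realType) (k N : nat) (q : 'I_k -> R)
    (i : 'I_k) (h : nat -> R) :
  \sum_(J : {ffun 'I_k -> 'I_N.+1}) bernstein_mx q J * h (J i) =
  \sum_(j < N.+1) bernstein (q i) N j * h j.
Proof.
pose F i' (j : 'I_N.+1) := bernstein (q i') N j * (if i' == i then h j else 1).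
transitivity (\sum_(J : {ffun 'I_k -> 'I_N.+1}) \prod_i' F i' (J i')).
  apply: eq_bigr => J _; rewrite /F big_split/=; congr (_ * _).
  by rewrite (bigD1 i)//= eqxx big1 ?mulr1// => i' /negbTE ->.
rewrite -(bigA_distr_bigA F) (bigD1 i)//= [X in _ * X]big1 ?mulr1.
  by apply: eq_bigr => j _; rewrite /F eqxx.
move=> i' /negbTE i'i; under eq_bigr do rewrite /F i'i mulr1.
exact: sum_bernstein.
Qed.

Lemma bernstein_mx_ge0 (R : realType) (k N : nat) (q : 'I_k -> R)
    (J : {ffun 'I_k -> 'I_N.+1}) :
  (forall i, 0 <= q i <= 1) -> 0 <= bernstein_mx q J.
Proof. by move=> q01; apply: prodr_ge0 => i _; exact: bernstein_ge0. Qed.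

(** The free phase [th] makes sines and constants available as cosines, so that this real span is an
    algebra and statements about it reduce to a single cosine. *)
Inductive trig_poly (R : realType) (k : nat) : ('rV[R]_k -> R) -> Prop :=
| trig_poly_cos (c : 'rV[R]_k) (th : R) :
    trig_poly (fun x => cos (\sum_i c ord0 i * x ord0 i + th))
| trig_poly_lin (a : R) (p q : 'rV[R]_k -> R) :
    trig_poly p -> trig_poly q -> trig_poly (fun x => a * p x + q x).

Lemma trig_poly0 (R : realType) (k : nat) : trig_poly (fun _ : 'rV[R]_k => 0).
Proof.
have t := trig_poly_cos (0 : 'rV[R]_k) 0; have := trig_poly_lin (-1) t t.
by congr trig_poly; apply/funext => x; ring.
Qed.

Lemma trig_polyZ (R : realType) (k : nat) (a : R) (p : 'rV[R]_k -> R) :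
  trig_poly p -> trig_poly (fun x => a * p x).
Proof.
move=> tp; have := trig_poly_lin a tp (trig_poly0 R k).
by congr trig_poly; apply/funext => x; rewrite addr0.
Qed.

Lemma trig_polyD (R : realType) (k : nat) (p q : 'rV[R]_k -> R) :
  trig_poly p -> trig_poly q -> trig_poly (fun x => p x + q x).
Proof.
move=> tp tq; have := trig_poly_lin 1 tp tq.
by congr trig_poly; apply/funext => x; rewrite mul1r.
Qed.

Lemma trig_poly_cst (R : realType) (k : nat) (a : R) :
  trig_poly (fun _ : 'rV[R]_k => a).
Proof.
have := trig_polyZ a (trig_poly_cos (0 : 'rV[R]_k) 0).
congr trig_poly; apply/funext => x; rewrite big1 ?addr0 ?cos0 ?mulr1// => i _.
by rewrite mxE mul0r.
Qed.

Lemma trig_polyM (R : realType) (k : nat) (p q : 'rV[R]_k -> R) :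
  trig_poly p -> trig_poly q -> trig_poly (fun x => p x * q x).
Proof.
elim=> [c th|a p1 p2 _ IH1 _ IH2] tq; last first.
  have := trig_poly_lin a (IH1 tq) (IH2 tq).
  by congr trig_poly; apply/funext => x; ring.
elim: tq => [c' th'|a q1 q2 _ IH1 _ IH2]; last first.
  have := trig_poly_lin a IH1 IH2.
  by congr trig_poly; apply/funext => x; ring.
have := trig_polyZ 2^-1 (trig_polyD (trig_poly_cos (c + c') (th + th'))
                                    (trig_poly_cos (c - c') (th - th'))).
congr trig_poly; apply/funext => x.
under eq_bigr do rewrite mxE mulrDl.
under [X in cos (X + (th - th'))]eq_bigr do rewrite !mxE mulrBl.
rewrite big_split/= sumrB.
set A := \sum_i c _ _ * _; set B := \sum_i c' _ _ * _.
have -> : A + B + (th + th') = (A + th) + (B + th') by ring.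
have -> : A - B + (th - th') = (A + th) - (B + th') by ring.
by rewrite cosD cosB; field.
Qed.

Lemma trig_poly_sum (R : realType) (k : nat) (I : Type) (s : seq I)
    (p : I -> 'rV[R]_k -> R) :
  (forall i, trig_poly (p i)) -> trig_poly (fun x => \sum_(i <- s) p i x).
Proof.
move=> tp; elim: s => [|i s IH].
  by under eq_fun do rewrite big_nil; exact: trig_poly_cst.
by under eq_fun do rewrite big_cons; exact: trig_polyD.
Qed.

Lemma trig_poly_prod (R : realType) (k : nat) (I : Type) (s : seq I)
    (p : I -> 'rV[R]_k -> R) :
  (forall i, trig_poly (p i)) -> trig_poly (fun x => \prod_(i <- s) p i x).
Proof.
move=> tp; elim: s => [|i s IH].
  by under eq_fun do rewrite big_nil; exact: trig_poly_cst.
by under eq_fun do rewrite big_cons; exact: trig_polyM.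
Qed.

Lemma trig_poly_bernstein (R : realType) (k N j : nat) (q : 'rV[R]_k -> R) :
  trig_poly q -> trig_poly (fun x => bernstein (q x) N j).
Proof.
move=> tq; elim: N j => [|N IH] j /=; first exact: trig_poly_cst.
have t1 := trig_polyM (trig_polyD (trig_poly_cst k 1) (trig_polyZ (-1) tq)) (IH j).
have t2 : trig_poly (fun x => if j is j'.+1 then q x * bernstein (q x) N j' else 0).
  by case: j {t1} => [|j]; [exact: trig_poly_cst | exact: trig_polyM].
have := trig_polyD t1 t2.
by congr trig_poly; apply/funext => x; rewrite mulN1r.
Qed.

Lemma trig_poly_sin_coord (R : realType) (k : nat) (i : 'I_k) (r : R) :
  trig_poly (fun x : 'rV[R]_k => sin (r * x ord0 i)).
Proof.
have := trig_poly_cos (r *: delta_mx ord0 i : 'rV[R]_k) (- (pi / 2)).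
congr trig_poly; apply/funext => x; rewrite cosBpihalf (bigD1 i)//= big1.
  by rewrite !mxE !eqxx mulr1 addr0.
by move=> j ji; rewrite !mxE (negbTE ji) andbF mulr0 mul0r.
Qed.

Lemma compact_box (R : realType) (k : nat) (M : R) :
  compact [set x : 'rV[R]_k | forall i, `|x ord0 i| <= M].
Proof.
rewrite (_ : mkset _ = [set x : 'rV[R]_k | forall i, `[- M, M]%classic (x ord0 i)]).
  by apply: (@rV_compact _ _ (fun=> `[- M, M]%classic)) => i; exact: segment_compact.
by apply/seteqP; split => x /= h i; have := h i; rewrite /= in_itv/= ler_norml.
Qed.

(* Substituting q_i = (1 + sin (x_i / M)) / 2 in the Bernstein polynomials of
   f turns them into trigonometric polynomials, which approximate f uniformly on
   a box and stay bounded off it; there the error is absorbed by |x_i|. *)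
Lemma trig_poly_approx (R : realType) (k : nat) (f : 'rV[R]_k -> R) (B eta : R) :
  continuous f -> (forall x, `|f x| <= B) -> 0 < eta ->
  exists2 p, trig_poly p &
    forall x, `|f x - p x| <= eta * (1 + \sum_i `|x ord0 i|).
Proof.
move=> cf fB eta0.
have B0 : 0 <= B := le_trans (normr_ge0 _) (fB 0).
(* Off the box some |x_i| exceeds M / 2, hence eta |x_i| exceeds 2 B, which bounds the error
   there. *)
pose M := 4 * B / eta + 1.
have M0 : 0 < M by rewrite ltr_wpDl// divr_ge0 ?mulr_ge0// ltW.
have [d d0 hd] := compact_unif_near (@compact_box R k (M / 2)) cf
  (divr_gt0 eta0 (ltr0n R 2)).
(* A distance d in x is d / M in the rescaled variable x / M; the cap 1 is what [sin_separation]
   asks for. *)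
pose delta := Num.min 1 (d / M).
have delta01 : 0 < delta <= 1 by rewrite lt_min ltr01 divr_gt0//= ge_min lexx.
have [gamma gamma0 hgamma] := sin_separation delta01.
(* Large enough for the total Chebyshev term 8 B k / (N gamma^2) to be at most eta / 2. *)
pose N := (Num.truncn (16 * B * k%:R / (gamma ^+ 2 * eta))).+1.
have N0 : 0 < N%:R :> R by rewrite ltr0n.
have hN : 8 * B * k%:R / (N%:R * gamma ^+ 2) <= eta / 2.
  have : 16 * B * k%:R / (gamma ^+ 2 * eta) <= N%:R by exact/ltW/truncnS_gt.
  rewrite ler_pdivrMr ?mulr_gt0 ?exprn_gt0// => h.
  rewrite ler_pdivrMr ?mulr_gt0 ?exprn_gt0//; lra.
pose q (i : 'I_k) (x : 'rV[R]_k) := 2^-1 * (1 + sin (M^-1 * x ord0 i)).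
have q01 i x : 0 <= q i x <= 1.
  have := sin_le1 (M^-1 * x ord0 i); have := sin_geN1 (M^-1 * x ord0 i).
  by rewrite /q => h1 h2; apply/andP; split; lra.
(* The node at which (1 + sin) / 2 equals j / N. *)
pose b (j : nat) : R := asin (2 * j%:R / N%:R - 1).
have bdom (j : nat) : (j < N.+1)%N -> -1 <= (2 * j%:R / N%:R - 1 : R) <= 1.
  move=> jN; have : 0 <= j%:R / N%:R :> R by rewrite divr_ge0.
  have : j%:R / N%:R <= 1 :> R by rewrite ler_pdivrMr// mul1r ler_nat -ltnS.
  by rewrite -mulrA => h1 h2; apply/andP; split; lra.
pose y (J : {ffun 'I_k -> 'I_N.+1}) : 'rV[R]_k := \row_i (M * b (J i)).
pose W (x : 'rV[R]_k) (J : {ffun 'I_k -> 'I_N.+1}) := bernstein_mx (fun i => q i x) J.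
exists (fun x => \sum_J W x J * f (y J)).
  apply: trig_poly_sum => J; apply: trig_polyM; last exact: trig_poly_cst.
  apply: trig_poly_prod => i; apply: trig_poly_bernstein.
  apply/trig_polyZ/trig_polyD; first exact: trig_poly_cst.
  exact: trig_poly_sin_coord.
move=> x.
have W0 J : 0 <= W x J by apply: bernstein_mx_ge0 => i.
have diff : `|f x - \sum_J W x J * f (y J)| <= \sum_J W x J * `|f x - f (y J)|.
  rewrite -[f x in leLHS]mul1r -(sum_bernstein_mx N (q ^~ x)) mulr_suml -sumrB.
  apply: (le_trans (ler_norm_sum _ _ _)); apply: ler_sum => J _.
  by rewrite -mulrBr normrM ger0_norm// W0.
have x0 : 0 <= \sum_i `|x ord0 i| by apply: sumr_ge0.
have [xM|/existsNP[i /negP]] := pselect (forall i, `|x ord0 i| <= M / 2); last first.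
  rewrite -ltNge => xi.
  have : 2 * B <= eta * `|x ord0 i|.
    apply: le_trans (ler_wpM2l (ltW eta0) (ltW xi)).
    rewrite /M; have -> : eta * ((4 * B / eta + 1) / 2) = 2 * B + eta / 2.
      by field; rewrite gt_eqF.
    by rewrite lerDl divr_ge0// ltW.
  have : `|x ord0 i| <= \sum_i `|x ord0 i|.
    by rewrite (bigD1 i)//= lerDl sumr_ge0.
  move=> h1 h2; apply: (le_trans diff).
  have : \sum_J W x J * `|f x - f (y J)| <= \sum_J W x J * (2 * B).
    apply: ler_sum => J _; rewrite ler_wpM2l//.
    by rewrite (le_trans (ler_normB _ _))// mulr2n mulrDl !mul1r lerD.
  rewrite -mulr_suml sum_bernstein_mx mul1r => /le_trans; apply.
  apply: (le_trans h2); rewrite ler_pM2l//; lra.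
suff : \sum_J W x J * `|f x - f (y J)| <= eta.
  move=> h; apply: (le_trans diff); apply: (le_trans h).
  by rewrite ler_pMr// lerDl.
(* Chebyshev's inequality: if coordinate i is at least delta away from its node, then gamma <= (2 /
   N) |J_i - N q_i|, so c (J_i - N q_i)^2 dominates the trivial bound 2 B. *)
pose c := 2 * B * (2 / (N%:R * gamma)) ^+ 2.
have c0 : 0 <= c by rewrite mulr_ge0 ?sqr_ge0// mulr_ge0.
have bound J : `|f x - f (y J)| <=
    eta / 2 + \sum_i c * ((J i)%:R - N%:R * q i x) ^+ 2.
  have s0 (P : pred 'I_k) : 0 <= \sum_(i | P i) c * ((J i)%:R - N%:R * q i x) ^+ 2.
    by apply: sumr_ge0 => i _; rewrite mulr_ge0 ?sqr_ge0.
  have [near|/existsNP[i /negP]] := pselect (forall i, `|M^-1 * x ord0 i - b (J i)| < delta).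
    apply: (@le_trans _ _ (eta / 2)); last by rewrite lerDl.
    apply: hd => //; split=> // i j; rewrite ord1 /ball/= mxE.
    have -> : x ord0 j - M * b (J j) = M * (M^-1 * x ord0 j - b (J j)).
      by field; rewrite gt_eqF.
    rewrite normrM gtr0_norm// mulrC -ltr_pdivlMr//.
    by rewrite (lt_le_trans (near j))// ge_min lexx orbT.
  rewrite -leNgt => far.
  have JiN := bdom _ (ltn_ord (J i)).
  have := hgamma _ _ _ _ far.
  have -> : sin (b (J i)) = 2 * (J i)%:R / N%:R - 1 by rewrite asinK ?in_itv.
  have -> : sin (M^-1 * x ord0 i) = 2 * q i x - 1 by rewrite /q; field.
  have -> : 2 * q i x - 1 - (2 * (J i)%:R / N%:R - 1) =
            - (2 / N%:R * ((J i)%:R - N%:R * q i x)).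
    by field; rewrite gt_eqF.
  rewrite normrN => /(_ _ _) h.
  have {h} : gamma <= `|2 / N%:R * ((J i)%:R - N%:R * q i x)|.
    apply: h.
      rewrite normrM gtr0_norm ?invr_gt0// mulrC ler_pdivrMr//.
      by rewrite mulrC; exact: xM.
    by rewrite ler_norml asin_geNpi2// asin_lepi2.
  move=> h.
  have h1 : 1 <= (2 / (N%:R * gamma)) ^+ 2 * ((J i)%:R - N%:R * q i x) ^+ 2.
    have -> : (2 / (N%:R * gamma)) ^+ 2 * ((J i)%:R - N%:R * q i x) ^+ 2 =
        `|2 / N%:R * ((J i)%:R - N%:R * q i x)| ^+ 2 / gamma ^+ 2.
      by rewrite real_normK ?num_real//; field; rewrite !gt_eqF.
    rewrite ler_pdivlMr ?exprn_gt0// mul1r.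
    by rewrite ler_sqr ?nnegrE// ltW.
  rewrite (bigD1 i)//=.
  have h2 : 2 * B <= c * ((J i)%:R - N%:R * q i x) ^+ 2.
    by rewrite /c -mulrA ler_peMr// mulr_ge0.
  have := s0 (fun j => j != i); have := ler_normB (f x) (f (y J)).
  have := fB x; have := fB (y J); lra.
apply: (@le_trans _ _ (\sum_J W x J * (eta / 2 + \sum_i c * ((J i)%:R - N%:R * q i x) ^+ 2))).
  by apply: ler_sum => J _; rewrite ler_wpM2l.
under eq_bigr do rewrite mulrDr mulr_sumr.
rewrite big_split/= -mulr_suml sum_bernstein_mx mul1r exchange_big/=.
have -> : \sum_i \sum_J W x J * (c * ((J i)%:R - N%:R * q i x) ^+ 2) =
          \sum_i c * (N%:R * (q i x * (1 - q i x))).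
  apply: eq_bigr => i _.
  rewrite /W (sum_bernstein_mx_coord _ (q ^~ x) i (fun j => c * (j%:R - N%:R * q i x) ^+ 2)).
  under eq_bigr do rewrite mulrCA.
  by rewrite -mulr_sumr sum_bernstein_sqr subrr expr0n add0r.
have : \sum_i c * (N%:R * (q i x * (1 - q i x))) <= \sum_(i < k) c * N%:R.
  apply: ler_sum => i _; rewrite ler_wpM2l// ler_piMr//.
  by have := q01 i x => /andP[h1 h2]; nra.
rewrite sumr_const card_ord -[_ *+ k]mulr_natr.
have -> : c * N%:R * k%:R = 8 * B * k%:R / (N%:R * gamma ^+ 2).
  by rewrite /c; field; rewrite !gt_eqF.
by move=> h; lra.
Qed.

(** * Convergence and equality in law through cosines *)

Lemma bounded_integrable (R : realType) d (Omega : measurableType d)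
    (P : probability Omega R) (U : Omega -> R) (B : R) :
  measurable_fun setT U -> (forall w, `|U w| <= B) ->
  P.-integrable setT (fun w => (U w)%:E).
Proof.
move=> mU UB.
apply: (@le_integrable _ _ _ P _ measurableT _ (EFin \o cst B)).
- exact/measurable_EFinP.
- by move=> w _; rewrite lee_fin (le_trans (UB w))// ler_norm.
- exact: finite_measure_integrable_cst.
Qed.

Lemma trig_poly_bounded (R : realType) (k : nat) (p : 'rV[R]_k -> R) :
  trig_poly p -> exists B, forall x, `|p x| <= B.
Proof.
elim=> [c th|a p1 p2 _ [B1 h1] _ [B2 h2]].
  by exists 1 => x; rewrite ler_norml cos_geN1 cos_le1.
exists (`|a| * B1 + B2) => x; rewrite (le_trans (ler_normD _ _))//.
by rewrite lerD// normrM ler_wpM2l.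
Qed.

Definition measurable_coords (R : realType) d (Omega : measurableType d) (k : nat)
  (Y : Omega -> 'rV[R]_k) := forall i, measurable_fun setT (fun w => Y w ord0 i).

Lemma measurable_trig_poly (R : realType) d (Omega : measurableType d) (k : nat)
    (Y : Omega -> 'rV[R]_k) (p : 'rV[R]_k -> R) :
  measurable_coords Y -> trig_poly p -> measurable_fun setT (fun w => p (Y w)).
Proof.
move=> mY; elim=> [c th|a p1 p2 _ h1 _ h2].
  apply: (measurableT_comp (continuous_measurable_fun (@continuous_cos R))).
  apply: measurable_funD => //; apply: measurable_sum => i.
  exact: measurable_funM.
by apply: measurable_funD => //; exact: measurable_funM.
Qed.

(** With eta = 1 / (n + 1), f is a pointwise limit of trigonometric polynomials, whose measurability
    is read off the coordinates. *)
Lemma measurable_continuous_coords (R : realType) d (Omega : measurableType d)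
    (k : nat) (Y : Omega -> 'rV[R]_k) (f : 'rV[R]_k -> R) (B : R) :
  measurable_coords Y -> continuous f -> (forall x, `|f x| <= B) ->
  measurable_fun setT (fun w => f (Y w)).
Proof.
move=> mY cf fB.
have H n : exists p, trig_poly p /\
    forall x, `|f x - p x| <= n.+1%:R^-1 * (1 + \sum_i `|x ord0 i|).
  by have [|p] := trig_poly_approx (eta := n.+1%:R^-1) cf fB;
    [rewrite invr_gt0 | exists p].
have [p hp] := choice H.
apply: (@measurable_fun_cvg _ _ _ _ (fun n w => p n (Y w))).
  by move=> n; apply: measurable_trig_poly => //; case: (hp n).
move=> w _; pose K := 1 + \sum_i `|Y w ord0 i|.
apply/cvgrPdist_le => e e0; near=> n.
apply: (le_trans ((hp n).2 (Y w))); rewrite -/K.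
have : K / e <= n%:R by near: n; exact: nbhs_infty_ger.
rewrite ler_pdivrMr// => /le_trans h.
by rewrite mulrC ler_pdivrMr// mulrC h// ler_pM2r// ler_nat.
Unshelve. all: by end_near. Qed.

(** Plays the role of tightness: the bound C turns the pointwise error eta (1 + sum_i |x_i|) into
    eta (1 + C) after integration. *)
Definition l1_bounded (R : realType) d (Omega : measurableType d)
    (P : probability Omega R) (k : nat) (C : R) (Y : Omega -> 'rV[R]_k) :=
  (forall i, P.-integrable setT (fun w => (Y w ord0 i)%:E)) /\
  \int[P]_w (\sum_i `|Y w ord0 i|) <= C.

Lemma l1_bounded_coords (R : realType) d (Omega : measurableType d)
    (P : probability Omega R) (k : nat) (C : R) (Y : Omega -> 'rV[R]_k) :
  l1_bounded P C Y -> measurable_coords Y.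
Proof. by move=> [iY _] i; apply/measurable_EFinP; exact: (measurable_int P (iY i)). Qed.

Lemma integral_trig_poly_approx (R : realType) d (Omega : measurableType d)
    (P : probability Omega R) (k : nat) (C B eta : R) (Y : Omega -> 'rV[R]_k)
    (f p : 'rV[R]_k -> R) :
  l1_bounded P C Y -> continuous f -> (forall x, `|f x| <= B) -> trig_poly p ->
  0 < eta -> (forall x, `|f x - p x| <= eta * (1 + \sum_i `|x ord0 i|)) ->
  `|\int[P]_w f (Y w) - \int[P]_w p (Y w)| <= eta * (1 + C).
Proof.
move=> lY cf fB tp eta0 fp; have mY := l1_bounded_coords lY; case: lY => iY YC.
have mf := measurable_continuous_coords mY cf fB.
have if_ := bounded_integrable P mf (fun w => fB (Y w)).
have mp := measurable_trig_poly mY tp.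
have [B' pB'] := trig_poly_bounded tp.
have ip := bounded_integrable P mp (fun w => pB' (Y w)).
have iS : P.-integrable setT (fun w => (\sum_i `|Y w ord0 i|)%:E).
  under eq_fun do rewrite -sumEFin; apply: integrable_sum => // i _.
  exact: (integrable_abse (iY i)).
have i1 : P.-integrable setT (fun w => (1 + \sum_i `|Y w ord0 i|)%:E).
  under eq_fun do rewrite EFinD; apply: integrableD => //.
  exact: (finite_measure_integrable_cst P).
have iD : P.-integrable setT (fun w => (f (Y w) - p (Y w))%:E).
  by under eq_fun do rewrite EFinB; exact: integrableB.
rewrite -RintegralB//; apply: (le_trans (le_normr_Rintegral _ _)) => //.
apply: (@le_trans _ _ (\int[P]_w (eta * (1 + \sum_i `|Y w ord0 i|)))).
  apply: le_Rintegral => //.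
  - exact: (integrable_abse iD).
  - by rewrite /comp; under eq_fun do rewrite EFinM; exact: integrableZl.
rewrite RintegralZl// ler_pM2l// RintegralD//; last first.
  exact: (finite_measure_integrable_cst P).
by rewrite Rintegral_cst//= probability_setT mulr1 lerD2l.
Qed.

Lemma integrable_trig_poly (R : realType) d (Omega : measurableType d)
    (P : probability Omega R) (k : nat) (Y : Omega -> 'rV[R]_k) (p : 'rV[R]_k -> R) :
  measurable_coords Y -> trig_poly p ->
  P.-integrable setT (fun w => (p (Y w))%:E).
Proof.
move=> mY tp; have [B pB] := trig_poly_bounded tp.
exact: bounded_integrable (measurable_trig_poly mY tp) (fun w => pB (Y w)).
Qed.

Lemma Rintegral_lin (R : realType) d (Omega : measurableType d)
    (P : probability Omega R) (a : R) (U V : Omega -> R) :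
  P.-integrable setT (fun w => (U w)%:E) ->
  P.-integrable setT (fun w => (V w)%:E) ->
  \int[P]_w (a * U w + V w) = a * \int[P]_w U w + \int[P]_w V w.
Proof.
move=> iU iV; rewrite RintegralD ?RintegralZl//.
by rewrite /comp; under eq_fun do rewrite EFinM; exact: integrableZl.
Qed.

(* A Cramer-Wold device. *)
Lemma cvg_integral_of_cos (R : realType) d (Omega : measurableType d)
    (P : probability Omega R) (k : nat) (C : R) (T : Type) (F : set_system T)
    (Y : T -> Omega -> 'rV[R]_k) (Z : Omega -> 'rV[R]_k) :
  Filter F -> (\forall t \near F, l1_bounded P C (Y t)) -> l1_bounded P C Z ->
  (forall (c : 'rV[R]_k) (th : R),
     \int[P]_w cos (\sum_i c ord0 i * Y t w ord0 i + th) @[t --> F] -->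
     \int[P]_w cos (\sum_i c ord0 i * Z w ord0 i + th)) ->
  forall (f : 'rV[R]_k -> R) (B : R), continuous f -> (forall x, `|f x| <= B) ->
  \int[P]_w f (Y t w) @[t --> F] --> \int[P]_w f (Z w).
Proof.
move=> FF lY lZ cosYZ f B cf fB.
have C0 : 0 <= C.
  by case: lZ => _; apply: le_trans; apply: Rintegral_ge0 => w _; exact: sumr_ge0.
have mZ := l1_bounded_coords lZ.
have trigYZ p : trig_poly p ->
    \int[P]_w p (Y t w) @[t --> F] --> \int[P]_w p (Z w).
  elim=> [c th|a p1 p2 t1 h1 t2 h2]; first exact: cosYZ.
  rewrite Rintegral_lin ?integrable_trig_poly//.
  have : a * \int[P]_w p1 (Y t w) + \int[P]_w p2 (Y t w) @[t --> F] -->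
      a * \int[P]_w p1 (Z w) + \int[P]_w p2 (Z w).
    by apply: cvgD => //; apply: cvgMr.
  apply: cvg_trans; apply: near_eq_cvg; near=> t.
  have mY : measurable_coords (Y t).
    by apply: (@l1_bounded_coords _ _ _ P _ C); near: t.
  by rewrite Rintegral_lin ?integrable_trig_poly.
apply/cvgrPdist_le => e e0.
pose eta := e / (3 * (1 + C)).
have C1 : 0 < 1 + C by rewrite ltr_pwDl.
have eta0 : 0 < eta by rewrite divr_gt0// mulr_gt0.
have etaE : eta * (1 + C) = e / 3 by rewrite /eta; field; rewrite gt_eqF.
have [p tp fp] := trig_poly_approx cf fB eta0.
have e3 : 0 < e / 3 by rewrite divr_gt0.
have /cvgrPdist_le/(_ _ e3) pYZ := trigYZ p tp.
near=> t.
have h1 := integral_trig_poly_approx lZ cf fB tp eta0 fp.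
have h2 : `|\int[P]_w f (Y t w) - \int[P]_w p (Y t w)| <= eta * (1 + C).
  by apply: (integral_trig_poly_approx (B := B)) => //; near: t.
have h3 : `|\int[P]_w p (Z w) - \int[P]_w p (Y t w)| <= e / 3 by near: t.
rewrite etaE in h1 h2.
move: h1 h2 h3; rewrite !ler_norml => /andP[? ?] /andP[? ?] /andP[? ?].
by apply/andP; split; lra.
Unshelve. all: by end_near. Qed.

(** A version of the distance to the complement of U, capped at 1 and phrased with balls only. The
    guard [0 < r] makes r = 0 always admissible, so the supremum is over a nonempty set. *)
Definition inner_radius (R : realType) (V : pseudoMetricType R) (U : set V) (x : V) : R :=
  sup [set r : R | 0 <= r <= 1 /\ (0 < r -> ball x r `<=` U)].

Lemma inner_radius_has_sup (R : realType) (V : pseudoMetricType R) (U : set V) (x : V) :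
  has_sup [set r : R | 0 <= r <= 1 /\ (0 < r -> ball x r `<=` U)].
Proof.
split; first by exists 0 => /=; rewrite lexx ler01 ltxx.
by exists 1 => r /= [/andP[]].
Qed.

Lemma inner_radius_ub (R : realType) (V : pseudoMetricType R) (U : set V) (x : V) (r : R) :
  0 <= r <= 1 -> (0 < r -> ball x r `<=` U) -> r <= inner_radius U x.
Proof.
by move=> r01 rU; apply: sup_upper_bound => //; exact: inner_radius_has_sup.
Qed.

Lemma inner_radius_01 (R : realType) (V : pseudoMetricType R) (U : set V) (x : V) :
  0 <= inner_radius U x <= 1.
Proof.
apply/andP; split; first by apply: inner_radius_ub; rewrite ?lexx ?ler01 ?ltxx.
apply: ge_sup; first by case: (inner_radius_has_sup U x).
by move=> r [/andP[]].
Qed.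

Lemma inner_radius_lip (R : realType) (V : pseudoMetricType R) (U : set V) (x y : V) (e : R) :
  0 < e -> ball x e y -> inner_radius U x - e <= inner_radius U y.
Proof.
move=> e0 xy; rewrite lerBlDr; apply: ge_sup.
  by case: (inner_radius_has_sup U x).
move=> r /= [/andP[r0 r1] rU]; rewrite -lerBlDr.
have /andP[g0 _] := inner_radius_01 U y.
have [re|re] := leP (r - e) 0; first exact: le_trans g0.
apply: inner_radius_ub; first by rewrite (ltW re)/=; lra.
move=> _ z yz; apply: rU; first lra.
have -> : r = e + (r - e) by ring.
exact: ball_triangle xy yz.
Qed.

Lemma inner_radius_continuous (R : realType) (V : pseudoMetricType R) (U : set V) :
  continuous (inner_radius U).
Proof.
move=> x; apply/cvgrPdist_le => e e0; near=> y.
have xy : ball x e y by near: y; exact: nbhsx_ballx.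
have h1 := inner_radius_lip U e0 xy.
have h2 := inner_radius_lip U e0 (ball_sym xy).
by rewrite ler_norml; apply/andP; split; lra.
Unshelve. all: by end_near. Qed.

Lemma inner_radius_gt0 (R : realType) (V : pseudoMetricType R) (U : set V) (x : V) :
  open U -> U x -> 0 < inner_radius U x.
Proof.
move=> oU Ux; have /nbhs_ballP[e /= e0 eU] := open_nbhs_nbhs (conj oU Ux).
apply: (@lt_le_trans _ _ (Num.min e 1)); first by rewrite lt_min e0 ltr01.
apply: inner_radius_ub; first by rewrite le_min ltW//= ler01 ge_min lexx orbT.
by move=> _; apply: subset_trans eU; apply: le_ball; rewrite ge_min lexx.
Qed.

Lemma inner_radius_eq0 (R : realType) (V : pseudoMetricType R) (U : set V) (x : V) :
  ~ U x -> inner_radius U x = 0.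
Proof.
move=> Ux; apply/eqP; rewrite eq_le (andP (inner_radius_01 U x)).1 andbT.
apply: ge_sup; first by case: (inner_radius_has_sup U x).
move=> r /= [/andP[r0 _] rU]; rewrite leNgt; apply/negP => r1.
by apply: Ux; apply: rU => //; exact: ballxx.
Qed.

Lemma inner_radius_norm (R : realType) (V : pseudoMetricType R) (U : set V) (x : V) :
  `|inner_radius U x| <= 1.
Proof. by have /andP[h0 h1] := inner_radius_01 U x; rewrite ger0_norm. Qed.

(** For open U these bounded continuous functions converge pointwise to the indicator of U, since
    the inner radius lies in ]0, 1] on U and is 0 off it. *)
Definition open_approx (R : realType) (V : pseudoMetricType R) (U : set V)
  (n : nat) (x : V) : R := 1 - (1 - inner_radius U x) ^+ n.

Lemma open_approx_norm (R : realType) (V : pseudoMetricType R) (U : set V)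
  (n : nat) (x : V) : `|open_approx U n x| <= 1.
Proof.
have /andP[h0 h1] := inner_radius_01 U x.
have k0 : 0 <= (1 - inner_radius U x) ^+ n by rewrite exprn_ge0// subr_ge0.
have k1 : (1 - inner_radius U x) ^+ n <= 1 by rewrite exprn_ile1//; lra.
by rewrite /open_approx ler_norml; apply/andP; split; lra.
Qed.

Lemma open_approx_continuous (R : realType) (V : pseudoMetricType R)
    (U : set V) (n : nat) :
  continuous (open_approx U n).
Proof.
have cB (g : V -> R) : continuous g -> continuous (fun x => 1 - g x).
  by move=> cg x; apply: cvgB; [exact: cvg_cst|exact: cg].
apply: (cB (fun x => (1 - inner_radius U x) ^+ n)) => x.
apply: (@continuous_comp _ _ _ (fun x => 1 - inner_radius U x) (fun r => r ^+ n)).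
  exact: (cB _ (inner_radius_continuous (U := U)) x).
exact: exprn_continuous.
Qed.

Lemma measurable_preimage_open (R : realType) d (Omega : measurableType d)
    (k : nat) (Y : Omega -> 'rV[R]_k) (U : set 'rV[R]_k) :
  measurable_coords Y -> open U -> measurable (Y @^-1` U).
Proof.
move=> mY oU.
have mg := measurable_continuous_coords mY (inner_radius_continuous (U := U))
  (inner_radius_norm U).
have -> : Y @^-1` U = setT `&` (fun w => inner_radius U (Y w)) @^-1` `]0, +oo[.
  apply/seteqP; split => w /=; rewrite in_itv/= andbT.
    by move=> Uw; split => //; exact: inner_radius_gt0.
  by move=> [_]; apply: contraPP => nU; rewrite inner_radius_eq0 ?ltxx.
by apply: mg => //; exact: measurable_itv.
Qed.

Lemma probability_open_lim (R : realType) d (Omega : measurableType d)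
    (P : probability Omega R) (k : nat) (Y : Omega -> 'rV[R]_k) (U : set 'rV[R]_k) :
  measurable_coords Y -> open U ->
  (\int[P]_w (open_approx U n (Y w))%:E)%E @[n --> \oo] -->
  P (Y @^-1` U).
Proof.
move=> mY oU; have mU := measurable_preimage_open mY oU.
have <- : (\int[P]_w (\1_(Y @^-1` U) w)%:E = P (Y @^-1` U))%E.
  by rewrite integral_indic// setIT.
have [//|||||_ _] := @dominated_convergence _ _ _ P setT measurableT
  (fun n w => (open_approx U n (Y w))%:E)
  (fun w => (\1_(Y @^-1` U) w)%:E) (cst 1%E).
- move=> n; apply/measurable_EFinP.
  exact: (measurable_continuous_coords mY (open_approx_continuous (U := U) (n := n))
    (open_approx_norm U n)).
- by apply/measurable_EFinP; exact: measurable_indic.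
- apply: aeW => w _; apply: cvg_EFin; first exact: nearW.
  rewrite indicE /open_approx /comp /=; have [Uw|nU] := pselect (U (Y w)).
    rewrite mem_set//=; rewrite -[X in _ --> X]subr0; apply: cvgB.
      exact: cvg_cst.
    apply: cvg_expr.
    have := inner_radius_gt0 oU Uw; have /andP[h0 h1] := inner_radius_01 U (Y w).
    by move=> h; rewrite ger0_norm; lra.
  rewrite memNset//= inner_radius_eq0//.
  by under eq_fun do rewrite /= subr0 expr1n subrr; exact: cvg_cst.
- exact: (finite_measure_integrable_cst P 1).
- by apply: aeW => w n _; rewrite lee_fin; exact: open_approx_norm.
- by apply.
Qed.

Lemma eq_probability_open (R : realType) d (Omega : measurableType d)
    (P : probability Omega R) (k : nat) (Y Z : Omega -> 'rV[R]_k) (B : set 'rV[R]_k) :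
  measurable_coords Y -> measurable_coords Z ->
  (forall (f : 'rV[R]_k -> R) (B : R), continuous f -> (forall x, `|f x| <= B) ->
     \int[P]_w f (Y w) = \int[P]_w f (Z w)) ->
  open B -> P (Y @^-1` B) = P (Z @^-1` B).
Proof.
move=> mY mZ YZ oB.
suff E : (fun n => \int[P]_w (open_approx B n (Y w))%:E)%E =
         (fun n => \int[P]_w (open_approx B n (Z w))%:E)%E.
  have lY := probability_open_lim (P := P) mY oB; rewrite E in lY.
  exact: cvg_unique lY (probability_open_lim (P := P) mZ oB).
apply/funext => n.
have cf := @open_approx_continuous _ _ B n; have fB := open_approx_norm B n.
have fin W : measurable_coords W ->
    (\int[P]_w (open_approx B n (W w))%:E)%E \is a fin_num.
  move=> mW; apply: integrable_fin_num => //.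
  exact: bounded_integrable (measurable_continuous_coords mW cf fB) (fun w => fB (W w)).
exact (etrans (esym (fineK (fin Y mY)))
  (etrans (f_equal EFin (YZ _ 1 cf fB)) (fineK (fin Z mZ)))).
Qed.

Lemma eq_probability_of_integral (R : realType) d (Omega : measurableType d)
    (P : probability Omega R) (k : nat) (Y Z : Omega -> 'rV[R]_k) :
  measurable_coords Y -> measurable_coords Z ->
  (forall (f : 'rV[R]_k -> R) (B : R), continuous f -> (forall x, `|f x| <= B) ->
     \int[P]_w f (Y w) = \int[P]_w f (Z w)) ->
  forall A, <<s [set B : set 'rV[R]_k | open B] >> A ->
    P (Y @^-1` A) = P (Z @^-1` A).
Proof.
move=> mY mZ YZ.
pose G := [set B : set 'rV[R]_k | open B].
pose T := g_sigma_algebraType G.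
have meas (W : Omega -> 'rV[R]_k) : measurable_coords W ->
    measurable_fun setT (W : Omega -> T).
  move=> mW; apply: (@measurability _ _ Omega T _ _ G) => //.
  by move=> _ [B oB <-]; rewrite setTI; exact: measurable_preimage_open.
pose Y' : {mfun Omega >-> T} := HB.pack (Y : Omega -> T)
  (isMeasurableFun.Build _ _ _ _ _ (meas _ mY)).
pose Z' : {mfun Omega >-> T} := HB.pack (Z : Omega -> T)
  (isMeasurableFun.Build _ _ _ _ _ (meas _ mZ)).
move=> A sA.
change (distribution P Y' A = distribution P Z' A).
apply: (g_sigma_algebra_measure_unique (T := T) G _ (fun=> setT)) => //.
- by move=> B oB; exact: sub_sigma_algebra.
- by move=> _; exact: openT.
- by apply/seteqP; split => // x _; exists 0%N.
- by move=> B1 B2 o1 o2; exact: openI.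
- by move=> B oB; exact: (eq_probability_open mY mZ YZ oB).
- by move=> _; rewrite (le_lt_trans (probability_le1 _ _)) ?ltry.
Qed.

Lemma eq_probability_of_cos (R : realType) d (Omega : measurableType d)
    (P : probability Omega R) (k : nat) (C : R) (Y Z : Omega -> 'rV[R]_k) :
  l1_bounded P C Y -> l1_bounded P C Z ->
  (forall (c : 'rV[R]_k) (th : R),
     \int[P]_w cos (\sum_i c ord0 i * Y w ord0 i + th) =
     \int[P]_w cos (\sum_i c ord0 i * Z w ord0 i + th)) ->
  forall A, <<s [set B : set 'rV[R]_k | open B] >> A ->
    P (Y @^-1` A) = P (Z @^-1` A).
Proof.
move=> lY lZ YZ; apply: eq_probability_of_integral.
- exact: l1_bounded_coords lY.
- exact: l1_bounded_coords lZ.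
- move=> f B cf fB.
  (* Equality is obtained from the convergence theorem applied to a constant sequence. *)
  have := @cvg_integral_of_cos _ _ _ P k C nat \oo (fun=> Y) Z _ _ lZ _ f B cf fB.
  move=> /(_ _ _ _)/cvg_lim => <- //; last 2 first.
  + by apply: nearW.
  + by move=> c th; rewrite YZ; exact: cvg_cst.
  by rewrite lim_cst.
Qed.

Lemma eq_law_of_cos (R : realType) d (Omega : measurableType d)
    (P : probability Omega R) (U V : Omega -> R) :
  P.-integrable setT (fun w => (U w)%:E) ->
  P.-integrable setT (fun w => (V w)%:E) ->
  (forall c th : R, \int[P]_w cos (c * U w + th) = \int[P]_w cos (c * V w + th)) ->
  eq_law P U V.
Proof.
move=> iU iV UV A mA.
pose row1 (W : Omega -> R) w : 'rV[R]_1 := \row_i W w.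
pose C := Num.max (\int[P]_w `|U w|) (\int[P]_w `|V w|).
have l1 W : P.-integrable setT (fun w => (W w)%:E) -> \int[P]_w `|W w| <= C ->
    l1_bounded P C (row1 W).
  move=> iW WC; split; first by move=> i; under eq_fun do rewrite mxE.
  by under eq_Rintegral do rewrite big_ord1 mxE.
have lU := l1 U iU; have lV := l1 V iV.
rewrite !le_max !lexx orbT/= in lU lV.
pose G := [set B : set 'rV[R]_1 | open B].
(* Open intervals generate the Borel sets of R and pull back to open sets of row vectors, so every
   Borel set of R becomes an admissible test set for vectors of length 1. *)
have mc : measurable_fun setT (fun x : g_sigma_algebraType G => (x : 'rV[R]_1) ord0 ord0).
  apply: (measurability (@RGenOpens.G R)).
    exact: RGenOpens.measurableE.
  move=> _ [B [x [y ->]] <-]; rewrite setTI; apply: sub_sigma_algebra => /=.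
  apply: open_comp; last exact: interval_open.
  by move=> z _; exact: coord_continuous.
have := @eq_probability_of_cos _ _ _ P 1 C (row1 U) (row1 V) (lU isT) (lV isT) _
  ((fun x : 'rV[R]_1 => x ord0 ord0) @^-1` A).
have E W : row1 W @^-1` ((fun x : 'rV[R]_1 => x ord0 ord0) @^-1` A) = W @^-1` A.
  by apply/seteqP; split => w /=; rewrite mxE.
rewrite !E; apply.
  move=> c th; under eq_Rintegral do rewrite big_ord1 mxE.
  by under [RHS]eq_Rintegral do rewrite big_ord1 mxE.
by rewrite -[X in <<s _ >> X]setTI; exact: (mc measurableT A mA).
Qed.

(** * Feature expansion of a positive semidefinite kernel *)

(** A list of weighted points is used as a finitely supported function: repetitions are harmless,
    and adding a point is a cons. *)
Definition quad_form (R : realType) (T : Type) (K : T -> T -> R) (s : seq (R * T)) : R :=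
  \sum_(p <- s) \sum_(q <- s) p.1 * q.1 * K p.2 q.2.

Definition psd_kernel (R : realType) (T : Type) (K : T -> T -> R) : Prop :=
  (forall u v, K u v = K v u) /\ forall s, 0 <= quad_form K s.

(** The covariance that remains after projecting off the variable at q. If K q q = 0, the convention
    x / 0 = 0 leaves K unchanged. *)
Definition schur_complement (R : realType) (T : Type) (K : T -> T -> R) (q : T) (u v : T) : R :=
  K u v - K u q * K q v / K q q.

Lemma psd_schur_complement (R : realType) (T : Type) (K : T -> T -> R) (q : T) :
  psd_kernel K -> psd_kernel (schur_complement K q).
Proof.
move=> [Ks Kp]; split=> [u v|s].
  by rewrite /schur_complement Ks (Ks q) (Ks u q); congr (_ - _ / _); rewrite mulrC.
pose L := \sum_(p <- s) p.1 * K p.2 q; pose a := K q q.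
have -> : quad_form (schur_complement K q) s = quad_form K s - L ^+ 2 / a.
  rewrite /quad_form expr2 mulr_suml mulr_suml -sumrB; apply: eq_bigr => p _.
  rewrite mulr_sumr mulr_suml -sumrB; apply: eq_bigr => p' _.
  by rewrite /schur_complement (Ks q) -/a; ring.
have [a0|a0] := eqVneq a 0; first by rewrite a0 invr0 mulr0 subr0.
(* The weight - L / a on q minimises the enlarged quadratic form, and the minimum is the form of the
   Schur complement. *)
have := Kp ((- L / a, q) :: s).
rewrite /quad_form big_cons big_cons /= -/a.
have -> : \sum_(j <- s) - L / a * j.1 * K q j.2 = - L / a * L.
  by rewrite [in RHS]/L mulr_sumr; apply: eq_bigr => p _; rewrite (Ks q) mulrA.
under eq_bigr do rewrite big_cons /=.
rewrite big_split/= -/(quad_form K s).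
have -> : \sum_(i <- s) i.1 * (- L / a) * K i.2 q = - L / a * L.
  rewrite -/L [RHS](_ : _ = - L / a * \sum_(p <- s) p.1 * K p.2 q)//.
  by rewrite mulr_sumr; apply: eq_bigr => p _; ring.
by congr (0 <= _); field.
Qed.

Fixpoint deflated_kernel (R : realType) (T : Type) (K : T -> T -> R) (q : nat -> T) (N : nat) :=
  if N is N'.+1 then schur_complement (deflated_kernel K q N') (q N') else K.

Lemma psd_deflated (R : realType) (T : Type) (K : T -> T -> R) (q : nat -> T) (N : nat) :
  psd_kernel K -> psd_kernel (deflated_kernel K q N).
Proof. by move=> Kp; elim: N => //= N; exact: psd_schur_complement. Qed.

Lemma psd_diag (R : realType) (T : Type) (K : T -> T -> R) (u : T) :
  psd_kernel K -> 0 <= K u u.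
Proof.
move=> [_ /(_ [:: (1, u)])]; rewrite /quad_form !big_seq1/=.
by rewrite !mul1r.
Qed.

Lemma psd_two (R : realType) (T : Type) (K : T -> T -> R) (a b : R) (u v : T) :
  psd_kernel K -> 0 <= a ^+ 2 * K u u + 2 * a * b * K u v + b ^+ 2 * K v v.
Proof.
move=> [Ks /(_ [:: (a, u); (b, v)])].
rewrite /quad_form !big_cons !big_nil/= (Ks v u); congr (0 <= _); ring.
Qed.

(** The squared canonical distance: the second moment of T u - T v for a centered field T with
    covariance K. *)
Definition kernel_dist (R : realType) (T : Type) (K : T -> T -> R) (u v : T) : R :=
  K u u - 2 * K u v + K v v.

Lemma kernel_dist_schur (R : realType) (T : Type) (K : T -> T -> R) (q u v : T) :
  psd_kernel K -> kernel_dist (schur_complement K q) u v <= kernel_dist K u v.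
Proof.
move=> Kp; rewrite /kernel_dist /schur_complement.
have Kq := psd_diag q Kp; case: Kp => Ks _.
have -> : K u u - K u q * K q u / K q q - 2 * (K u v - K u q * K q v / K q q) +
          (K v v - K v q * K q v / K q q) =
          K u u - 2 * K u v + K v v - (K u q - K v q) ^+ 2 / K q q.
  by rewrite (Ks q u) (Ks q v); ring.
by rewrite gerBl divr_ge0// sqr_ge0.
Qed.

Lemma schur_complement_diag (R : realType) (T : Type) (K : T -> T -> R) (q u : T) :
  psd_kernel K -> schur_complement K q u u <= K u u.
Proof.
move=> Kp; have Kq := psd_diag q Kp; case: Kp => Ks _.
by rewrite /schur_complement (Ks q u) gerBl divr_ge0// -expr2 sqr_ge0.
Qed.

(** Once q i has been processed its residual variance is 0 for good, and deflation never increases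
    distances; so the residual at u is controlled by the distance from u to q i. *)
Lemma deflated_cvg0 (R : realType) (T : Type) (K : T -> T -> R) (q : nat -> T) (u : T) :
  psd_kernel K -> (forall e, 0 < e -> exists i, kernel_dist K u (q i) < e) ->
  deflated_kernel K q N u u @[N --> \oo] --> 0.
Proof.
move=> Kp dense; apply/cvgr0Pnorm_lt => e e0.
have [i hi] := dense _ (divr_gt0 e0 (ltr0n R 2)).
exists i.+1 => // N /= iN.
have Kn n := psd_deflated q n Kp.
have qi0 n : (i < n)%N -> deflated_kernel K q n (q i) (q i) <= 0.
  elim: n => // n IH; rewrite ltnS leq_eqVlt => /predU1P[->|/IH h].
    rewrite /= /schur_complement; have [->|h] := eqVneq (deflated_kernel K q n (q n) (q n)) 0.
      by rewrite invr0 !mulr0 subr0.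
    by rewrite mulfK// subrr.
  by rewrite (le_trans _ h)// schur_complement_diag.
have distn n : kernel_dist (deflated_kernel K q n) u (q i) <= kernel_dist K u (q i).
  elim: n => // n IH; apply: le_trans IH; exact: kernel_dist_schur.
rewrite ger0_norm ?psd_diag//.
(* The weights 1 and -2 give, for the deflated kernel, K u u <= 2 dist(u, q i) + 2 K (q i) (q i), so
   that no Cauchy-Schwarz inequality is required. *)
have := psd_two 1 (-2) u (q i) (Kn N); have := qi0 _ iN; have := distn N.
rewrite /kernel_dist in hi *.
by move=> h1 h2 h3; lra.
Qed.

(** The coordinate of u along the j-th Gram-Schmidt vector. A vanishing residual at q j makes it 0
    by the convention x / 0 = 0, in agreement with the unchanged Schur complement. *)
Definition kernel_feature (R : realType) (T : Type) (K : T -> T -> R) (q : nat -> T)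
    (j : nat) (u : T) : R :=
  deflated_kernel K q j u (q j) / Num.sqrt (deflated_kernel K q j (q j) (q j)).

Lemma kernel_featureM (R : realType) (T : Type) (K : T -> T -> R) (q : nat -> T) (N : nat) (u v : T) :
  psd_kernel K ->
  \sum_(j < N) kernel_feature K q j u * kernel_feature K q j v =
  K u v - deflated_kernel K q N u v.
Proof.
move=> Kp; elim: N => [|N IH]; first by rewrite big_ord0 subrr.
have KN := psd_deflated q N Kp.
rewrite big_ord_recr/= IH /schur_complement /kernel_feature.
rewrite mulrACA -invfM -expr2 sqr_sqrtr ?psd_diag//.
by case: KN => Ks _; rewrite (Ks (q N) v); ring.
Qed.

Lemma kernel_expansion (R : realType) (T : Type) (K : T -> T -> R) (q : nat -> T) :
  psd_kernel K -> (forall u e, 0 < e -> exists i, kernel_dist K u (q i) < e) ->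
  exists f : nat -> T -> R, forall u v,
    \sum_(j < N) f j u * f j v @[N --> \oo] --> K u v.
Proof.
move=> Kp dense; exists (kernel_feature K q) => u v.
suff : K u v - deflated_kernel K q N u v @[N --> \oo] --> K u v - 0.
  by rewrite subr0; apply: cvg_trans; apply: near_eq_cvg; apply: nearW => N;
    rewrite kernel_featureM.
apply: cvgB; first exact: cvg_cst.
have Kn n := psd_deflated q n Kp.
have hu := deflated_cvg0 Kp (dense u); have hv := deflated_cvg0 Kp (dense v).
have h : deflated_kernel K q N u u + deflated_kernel K q N v v @[N --> \oo] --> 0.
  by rewrite -[X in _ --> X]addr0; exact: cvgD.
apply: (@squeeze_cvgr _ _ _ _ (fun N =>
    - (deflated_kernel K q N u u + deflated_kernel K q N v v))
  (fun N => deflated_kernel K q N u u + deflated_kernel K q N v v)) => //.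
  apply: nearW => N; have := psd_two 1 1 u v (Kn N).
  have := psd_two 1 (-1) u v (Kn N); have := psd_diag u (Kn N).
  have := psd_diag v (Kn N).
  by move=> h1 h2 h3 h4; apply/andP; split; lra.
by rewrite -[X in _ --> X]oppr0; exact: cvgN.
Qed.

(** * Orthonormal sequences and almost sure limits *)

Lemma cvg_sum (R : realType) (T : Type) (F : set_system T) (I : Type) (s : seq I)
    (f : I -> T -> R) (l : I -> R) :
  Filter F -> (forall i, f i x @[x --> F] --> l i) ->
  \sum_(i <- s) f i x @[x --> F] --> \sum_(i <- s) l i.
Proof.
move=> FF fl; elim: s => [|i s IH].
  by rewrite big_nil; under eq_fun do rewrite big_nil; exact: cvg_cst.
by rewrite big_cons; under eq_fun do rewrite big_cons; exact: cvgD.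
Qed.

Definition covar (R : realType) d (Omega : measurableType d)
  (P : probability Omega R) (U V : Omega -> R) : R := \int[P]_w (U w * V w).

Lemma covarC (R : realType) d (Omega : measurableType d)
  (P : probability Omega R) (U V : Omega -> R) : covar P U V = covar P V U.
Proof. by apply: eq_Rintegral => w _; rewrite mulrC. Qed.

Lemma covar_sqr (R : realType) d (Omega : measurableType d)
  (P : probability Omega R) (U : Omega -> R) : covar P U U = \int[P]_w (U w ^+ 2).
Proof. by []. Qed.

Lemma covar_linl (R : realType) d (Omega : measurableType d)
    (P : probability Omega R) (a : R) (U V W : Omega -> R) :
  square_integrable P U -> square_integrable P V -> square_integrable P W ->
  covar P (fun w => a * U w + V w) W = a * covar P U W + covar P V W.
Proof.
move=> sU sV sW; rewrite /covar -Rintegral_lin; try exact: square_integrableM.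
by apply: eq_Rintegral => w _; rewrite mulrDl mulrA.
Qed.

Lemma square_integrable_sum (R : realType) d (Omega : measurableType d)
    (P : probability Omega R) (I : Type) (s : seq I) (a : I -> R) (U : I -> Omega -> R) :
  (forall i, square_integrable P (U i)) ->
  square_integrable P (fun w => \sum_(i <- s) a i * U i w).
Proof.
move=> sU; elim: s => [|i s IH].
  by under eq_fun do rewrite big_nil; exact: square_integrable_cst.
by under eq_fun do rewrite big_cons; exact: square_integrable_lin.
Qed.

Lemma covar_suml (R : realType) d (Omega : measurableType d)
    (P : probability Omega R) (I : Type) (s : seq I) (a : I -> R)
    (U : I -> Omega -> R) (W : Omega -> R) :
  (forall i, square_integrable P (U i)) -> square_integrable P W ->
  covar P (fun w => \sum_(i <- s) a i * U i w) W = \sum_(i <- s) a i * covar P (U i) W.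
Proof.
move=> sU sW; elim: s => [|i s IH].
  rewrite big_nil /covar; under eq_Rintegral do rewrite big_nil mul0r.
  by rewrite Rintegral_cst// mul0r.
rewrite big_cons -IH -covar_linl//; last exact: square_integrable_sum.
by apply: eq_Rintegral => w _; rewrite big_cons.
Qed.

Lemma covar_sum (R : realType) d (Omega : measurableType d)
    (P : probability Omega R) (I J : Type) (s : seq I) (t : seq J) (a : I -> R)
    (b : J -> R) (U : I -> Omega -> R) (V : J -> Omega -> R) :
  (forall i, square_integrable P (U i)) -> (forall j, square_integrable P (V j)) ->
  covar P (fun w => \sum_(i <- s) a i * U i w) (fun w => \sum_(j <- t) b j * V j w) =
  \sum_(i <- s) \sum_(j <- t) a i * b j * covar P (U i) (V j).
Proof.
move=> sU sV; rewrite covar_suml//; last exact: square_integrable_sum.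
apply: eq_bigr => i _; rewrite covarC covar_suml// mulr_sumr.
by apply: eq_bigr => j _; rewrite covarC mulrA.
Qed.

Lemma gaussian_space_sum (R : realType) d (Omega : measurableType d)
    (P : probability Omega R) (H : set (Omega -> R)) (I : Type) (s : seq I)
    (a : I -> R) (U : I -> Omega -> R) :
  gaussian_space P H -> (forall i, H (U i)) ->
  H (fun w => \sum_(i <- s) a i * U i w).
Proof.
move=> [H0 HL _ _ _] HU; elim: s => [|i s IH].
  by under eq_fun do rewrite big_nil; exact: H0.
by under eq_fun do rewrite big_cons; exact: HL.
Qed.

Lemma gaussian_spaceZ (R : realType) d (Omega : measurableType d)
    (P : probability Omega R) (H : set (Omega -> R)) (a : R) (U : Omega -> R) :
  gaussian_space P H -> H U -> H (fun w => a * U w).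
Proof.
move=> [H0 HL _ _ _] HU; have := HL a _ _ HU H0.
by congr H; apply/funext => w; rewrite addr0.
Qed.

Definition orthonormal_seq (R : realType) d (Omega : measurableType d)
    (P : probability Omega R) (s : seq (Omega -> R)) : Prop :=
  forall i j, (i < size s)%N -> (j < size s)%N ->
    covar P (nth (cst 0) s i) (nth (cst 0) s j) = (i == j)%:R.

(* Elements of variance 1 that are asymptotically orthogonal to each element of
   the space; for a stationary field they are its values far from the origin. *)
Definition escaping (R : realType) d (Omega : measurableType d)
    (P : probability Omega R) (H : set (Omega -> R)) : Prop :=
  exists X : nat -> Omega -> R,
    [/\ forall n, H (X n), forall n, covar P (X n) (X n) = 1 &
        forall U, H U -> covar P U (X n) @[n --> \oo] --> 0].

(** Far out, the squared projections of X n on the members of s sum to less than 1, so the residual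
    W of X n has positive variance and can be normalised. *)
Lemma orthonormal_extend (R : realType) d (Omega : measurableType d)
    (P : probability Omega R) (H : set (Omega -> R)) (s : seq (Omega -> R)) :
  gaussian_space P H -> escaping P H ->
  (forall i, H (nth (cst 0) s i)) -> orthonormal_seq P s ->
  exists2 U, H U & orthonormal_seq P (rcons s U).
Proof.
move=> gH [X [HX X1 XU]] Hs os.
have sH U : H U -> square_integrable P U by case: gH => _ _ h _ _; exact: h.
pose x i := nth (cst 0) s i.
have sx i : square_integrable P (x i) by exact/sH/Hs.
have : \sum_(i < size s) (covar P (x i) (X n)) ^+ 2 @[n --> \oo] --> 0.
  rewrite -[X in _ --> X](_ : \sum_(i < size s) (0 : R) ^+ 2 = _); last first.
    by rewrite big1// => i _; rewrite expr0n.
  apply: cvg_sum => i; apply: (cvg_comp _ (fun z => z ^+ 2) (XU _ (Hs i))).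
  exact: exprn_continuous.
move=> /cvgr0Pnorm_lt/(_ 1 ltr01)[n _ /(_ n (leqnn n))] /= hn.
pose a (i : 'I_(size s)) := - covar P (x i) (X n).
pose W w := 1 * X n w + \sum_(i < size s) a i * x i w.
have HS : H (fun w => \sum_(i < size s) a i * x i w) 
  by apply: (gaussian_space_sum _ _ gH) => i; exact: Hs.
have HW : H W by case: gH => _ h _ _ _; exact: h.
have xx (i j : 'I_(size s)) : covar P (x i) (x j) = (i == j)%:R by rewrite os.
have Wx (j : 'I_(size s)) : covar P W (x j) = 0.
  rewrite /W covar_linl ?covar_suml//; try exact: sH.
  rewrite (bigD1 j)//= big1; last first.
    by move=> i /negbTE ij; rewrite xx ij mulr0.
  rewrite xx eqxx mulr1 addr0 mul1r (_ : covar P (X n) (x j) = - a j) ?addNr//.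
  by rewrite /a opprK covarC.
have WX : covar P W (X n) = 1 - \sum_(i < size s) (covar P (x i) (X n)) ^+ 2.
  rewrite /W covar_linl ?covar_suml//; try exact: sH.
  rewrite X1 mulr1 -sumrN; congr (_ + _); apply: eq_bigr => i _.
  by rewrite /a; ring.
(* W is orthogonal to each x i, so only its component X n contributes. *)
have WW : covar P W W = covar P W (X n).
  rewrite {1}/W covar_linl ?covar_suml//; try exact: sH.
  rewrite mul1r (covarC P (X n)) big1 ?addr0// => i _.
  by rewrite covarC Wx mulr0.
have WW0 : 0 < covar P W W.
  by rewrite WW WX subr_gt0; apply: le_lt_trans hn; exact: ler_norm.
pose b := (Num.sqrt (covar P W W))^-1.
exists (fun w => b * W w); first exact: (gaussian_spaceZ _ gH).
have covZ V : H V -> covar P (fun w => b * W w) V = b * covar P W V.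
  move=> HV; rewrite /covar -RintegralZl//; last exact/square_integrableM/sH/HV/sH.
  by apply: eq_Rintegral => w _; rewrite mulrA.
have bW : covar P (fun w => b * W w) (fun w => b * W w) = 1.
  rewrite covZ; last exact: (gaussian_spaceZ _ gH).
  rewrite covarC covZ// /b mulrA -invfM -expr2 sqr_sqrtr ?ltW//.
  by rewrite mulVf// gt_eqF.
move=> i j; rewrite size_rcons !ltnS !nth_rcons.
case: (ltngtP i (size s)) => // si _; case: (ltngtP j (size s)) => // sj _.
- by rewrite os.
- by rewrite sj covarC covZ ?(Wx (Ordinal si)) ?mulr0 ?ltn_eqF//; exact: Hs.
- by rewrite si covZ ?(Wx (Ordinal sj)) ?mulr0 ?gtn_eqF//; exact: Hs.
- by rewrite si sj eqxx.
Qed.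

Lemma orthonormal_sequence (R : realType) d (Omega : measurableType d)
    (P : probability Omega R) (H : set (Omega -> R)) :
  gaussian_space P H -> escaping P H ->
  exists xi : nat -> Omega -> R, (forall i, H (xi i)) /\
    forall i j, covar P (xi i) (xi j) = (i == j)%:R.
Proof.
move=> gH eH; have H0 : H (cst 0) by case: gH.
(* Indices past the end yield the default [cst 0], which lies in H; the first condition can thus
   range over all i. *)
pose good s := (forall i, H (nth (cst 0) s i)) /\ orthonormal_seq P s.
have step s : exists U, good s -> good (rcons s U).
  have [[Hs os]|ns] := pselect (good s); last by exists (cst 0).
  have [U HU oU] := orthonormal_extend gH eH Hs os; exists U => _; split => // i.
  by rewrite nth_rcons; case: ifP => // _; case: ifP.
have [g hg] := choice step.
pose S := fix S n := if n is n'.+1 then rcons (S n') (g (S n')) else [::].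
have goodS n : good (S n).
  by elim: n => [|n /hg //]; split => [i|[|i] [|j]//]; rewrite nth_nil.
have sizeS n : size (S n) = n by elim: n => //= n IH; rewrite size_rcons IH.
have nthS n i : (i < n)%N -> nth (cst 0) (S n) i = g (S i).
  elim: n => // n IH; rewrite ltnS leq_eqVlt /= nth_rcons sizeS.
  by move=> /predU1P[->|h]; [rewrite ltnn eqxx|rewrite h IH].
exists (fun n => g (S n)); split => [i|i j].
  by rewrite -(nthS i.+1)//; case: (goodS i.+1).
have [_ os] := goodS (maxn i j).+1.
rewrite -(nthS (maxn i j).+1 i) ?ltnS ?leq_maxl//.
rewrite -(nthS (maxn i j).+1 j) ?ltnS ?leq_maxr//.
by rewrite os ?sizeS ?ltnS ?leq_maxl ?leq_maxr.
Qed.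

Lemma square_integrable_sub (R : realType) d (Omega : measurableType d)
    (P : probability Omega R) (U V : Omega -> R) :
  square_integrable P U -> square_integrable P V ->
  square_integrable P (fun w => U w - V w).
Proof.
move=> sU sV; have := square_integrable_lin (-1) sV sU.
by congr square_integrable; apply/funext => w; rewrite mulN1r addrC.
Qed.

(* AM-GM: |D| <= (2^k D^2 + 2^-k) / 2 *)
Lemma l1_le_of_l2 (R : realType) d (Omega : measurableType d)
    (P : probability Omega R) (D : Omega -> R) (c : R) : 0 < c ->
  square_integrable P D -> \int[P]_w (D w ^+ 2) <= c ^+ 2 ->
  \int[P]_w `|D w| <= c.
Proof.
move=> c0 sD Dc; have iD := square_integrable_integrable sD.
have i2 := sD.2; have ic := finite_measure_integrable_cst P c.
pose a := (2 * c)^-1.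
apply: (@le_trans _ _ (\int[P]_w (a * D w ^+ 2 + c / 2))).
  apply: le_Rintegral => //.
  - exact: (integrable_abse iD).
  - rewrite /comp; under eq_fun do rewrite EFinD EFinM.
    by apply: integrableD => //;
      [exact: integrableZl | exact: (finite_measure_integrable_cst P (c / 2))].
  - move=> w _; rewrite -(real_normK (num_real (D w))).
    rewrite -subr_ge0 (_ : _ - _ = a * (`|D w| - c) ^+ 2); last first.
      by rewrite /a; field; rewrite gt_eqF.
    by rewrite mulr_ge0 ?sqr_ge0// invr_ge0 mulr_ge0// ltW.
rewrite Rintegral_lin//; last exact: (finite_measure_integrable_cst P (c / 2)).
rewrite Rintegral_cst//= probability_setT mulr1.
have : a * \int[P]_w (D w ^+ 2) <= a * c ^+ 2.
  by rewrite ler_wpM2l// invr_ge0 mulr_ge0// ltW.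
have -> : a * c ^+ 2 = c / 2 by rewrite /a; field; rewrite gt_eqF.
by rewrite /=; lra.
Qed.

(** The increments are at most 2^-k in L^2, hence in L^1; the sum G of their absolute values has a
    finite integral, is finite almost everywhere, and there the series converges absolutely. *)
Lemma fast_cauchy_limit (R : realType) d (Omega : measurableType d)
    (P : probability Omega R) (S : nat -> Omega -> R) :
  (forall k, square_integrable P (S k)) ->
  (forall k, \int[P]_w ((S k.+1 w - S k w) ^+ 2) <= (2^-1 ^+ k) ^+ 2) ->
  exists T : Omega -> R, P.-integrable setT (fun w => (T w)%:E) /\
    {ae P, forall w, S k w @[k --> \oo] --> T w}.
Proof.
move=> sS hS.
have iS k := square_integrable_integrable (sS k).
pose D k w := S k.+1 w - S k w.
have sD k : square_integrable P (D k) by exact: square_integrable_sub.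
have iD k := square_integrable_integrable (sD k).
have mD k : measurable_fun setT (fun w => `|(D k w)%:E|%E).
  by apply: measurableT_comp => //; exact: (measurable_int P (iD k)).
have D1 k : (\int[P]_w `|(D k w)%:E| <= (2^-1 ^+ k)%:E)%E.
  have := l1_le_of_l2 (exprn_gt0 k (_ : 0 < 2^-1)) (sD k) (hS k).
  rewrite invr_gt0 ltr0n => /(_ isT).
  rewrite -lee_fin /Rintegral fineK//.
  apply: integrable_fin_num => //; exact: (integrable_abse (iD k)).
pose G w := (\sum_(k <oo) `|(D k w)%:E|)%E.
have G0 w : (0 <= G w)%E by exact: nneseries_ge0.
have mG : measurable_fun setT G by exact: ge0_emeasurable_sum.
have intG : (\int[P]_w G w < +oo)%E.
  rewrite /G integral_nneseries//.
  apply: (@le_lt_trans _ _ 2%:E); last exact: ltry.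
  apply: lime_le; first by apply: is_cvg_nneseries => k _ _; exact: integral_ge0.
  apply: nearW => n; apply: (@le_trans _ _ (\sum_(0 <= k < n) (2^-1 ^+ k)%:E)%E).
    by apply: lee_sum => k _; exact: D1.
  rewrite sumEFin lee_fin.
  have -> : \sum_(0 <= k < n) 2^-1 ^+ k = 2 - 2 * 2^-1 ^+ n :> R.
    elim: n => [|n IH]; first by rewrite big_nil expr0; ring.
    by rewrite big_nat_recr//= IH exprS; field.
  by rewrite gerBl mulr_ge0// exprn_ge0// invr_ge0.
have iG : P.-integrable setT G.
  apply/integrableP; split => //.
  by under eq_integral do rewrite gee0_abs//.
have cvgS w : G w \is a fin_num -> cvg (S k w @[k --> \oo]).
  move=> Gw.
  have : cvgn (series (fun k => D k w)).
    apply: normed_cvg.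
    pose N n := \sum_(0 <= k < n) `|D k w|.
    suff cN : cvgn N by exact: cN.
    apply: nondecreasing_is_cvgn.
      by apply/nondecreasing_seqP => n; rewrite /N big_nat_recr//= lerDl.
    exists (fine (G w)) => _ [n _ <-].
    rewrite -lee_fin fineK// /N -sumEFin.
    exact: (@nneseries_lim_ge _ (fun k => `|(D k w)%:E|%E) xpredT 0%N n).
  move=> cD.
  have -> : (fun k => S k w) = (fun k => S 0%N w + series (fun k => D k w) k).
    apply/funext => k; rewrite /series/= /D.
    elim: k => [|k IH]; first by rewrite big_nil addr0.
    by rewrite big_nat_recr//= addrA -IH; ring.
  by apply: is_cvgD => //; exact: is_cvg_cst.
(* Cutting off outside A makes the sequence converge at every point, so that its limit T is
   measurable. *)
pose A := [set w | G w \is a fin_num].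
have mA : measurable A.
  by rewrite -[A]setTI; exact: emeasurable_fin_num.
pose T w := lim ((S k w * \1_A w) @[k --> \oo]).
have cvgT w : S k w * \1_A w @[k --> \oo] --> T w.
  rewrite /T indicE; have [Aw|Aw] := pselect (A w).
    rewrite mem_set//; apply: is_cvgM; [exact: cvgS|exact: is_cvg_cst].
  by rewrite memNset//; under eq_fun do rewrite mulr0; exact: is_cvg_cst.
have mT : measurable_fun setT T.
  apply: (@measurable_fun_cvg _ _ _ _ (fun k w => S k w * \1_A w)) => //.
  by move=> k; apply: measurable_funM; [exact: (sS k).1|exact: measurable_indic].
have aeT : {ae P, forall w, S k w @[k --> \oo] --> T w}.
  apply: filterS (integrable_ae measurableT iG) => w /(_ I) Gw.
  by have := cvgT w; rewrite indicE mem_set//; under eq_fun do rewrite mulr1.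
exists T; split => //.
(* Used for the integrability of T, with |S 0| + G as dominating function. *)
have [//|||||iT _ _] := @dominated_convergence _ _ _ P setT measurableT
  (fun k w => (S k w)%:E) (fun w => (T w)%:E) (fun w => `|(S 0%N w)%:E| + G w)%E.
- by move=> k; exact: (measurable_int P (iS k)).
- exact/measurable_EFinP.
- apply: filterS aeT => w Sw _.
  by apply: cvg_EFin; [exact: nearW|exact: Sw].
- by apply: integrableD => //; exact: (integrable_abse (iS 0%N)).
- apply: aeW => w n _.
  have h : `|S n w| <= `|S 0%N w| + \sum_(0 <= k < n) `|D k w|.
    elim: n => [|n IH]; first by rewrite big_nil addr0.
    rewrite big_nat_recr//= addrA.
    have -> : S n.+1 w = S n w + D n w by rewrite /D; ring.
    by rewrite (le_trans (ler_normD _ _))// lerD2r.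
  rewrite (@le_trans _ _ (`|S 0%N w| + \sum_(0 <= k < n) `|D k w|)%:E)//.
  rewrite EFinD leeD2l// -sumEFin.
  exact: (@nneseries_lim_ge _ (fun k => `|(D k w)%:E|%E) xpredT 0%N n).
- exact: iT.
Qed.

Lemma cvg_integral_cos (R : realType) d (Omega : measurableType d)
    (P : probability Omega R) (V : nat -> Omega -> R) (W : Omega -> R) (a th : R) :
  (forall k, measurable_fun setT (V k)) -> measurable_fun setT W ->
  {ae P, forall w, V k w @[k --> \oo] --> W w} ->
  \int[P]_w cos (a * V k w + th) @[k --> \oo] --> \int[P]_w cos (a * W w + th).
Proof.
move=> mV mW VW.
have mc (U : Omega -> R) : measurable_fun setT U ->
    measurable_fun setT (fun w => cos (a * U w + th)).
  move=> mU; apply: (measurableT_comp (continuous_measurable_fun (@continuous_cos R))).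
  by apply: measurable_funD => //; exact: measurable_funM.
have bc (x : R) : `|cos x| <= 1 by rewrite ler_norml cos_geN1 cos_le1.
have [//|||||iW _ cW] := @dominated_convergence _ _ _ P setT measurableT
  (fun k w => (cos (a * V k w + th))%:E) (fun w => (cos (a * W w + th))%:E) (cst 1%E).
- by move=> k; apply/measurable_EFinP; exact: mc.
- by apply/measurable_EFinP; exact: mc.
- apply: filterS VW => w Vw _; apply: cvg_EFin; first exact: nearW.
  apply: (cvg_comp (fun k => a * V k w + th) (@cos R)); last exact: continuous_cos.
  by apply: cvgD; [exact: cvgMr|exact: cvg_cst].
- exact: (finite_measure_integrable_cst P 1).
- by apply: aeW => w n _; rewrite lee_fin.
by apply: fine_cvg; rewrite fineK//; exact: integrable_fin_num.
Qed.

(** * Gaussian fields with prescribed covariance *)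

Lemma sum_orthonormal (R : realType) (N M : nat) (a b : nat -> R) :
  \sum_(i < N) \sum_(j < M) a i * b j * (i == j :> nat)%:R =
  \sum_(j < minn N M) a j * b j.
Proof.
wlog NM : N M a b / (N <= M)%N => [wl|].
  case: (boolP (N <= M)%N) => [/wl//|]; rewrite -ltnNge => /ltnW MN.
  rewrite exchange_big/= minnC; under [RHS]eq_bigr do rewrite mulrC.
  rewrite -(wl M N b a MN); apply: eq_bigr => j _; apply: eq_bigr => i _.
  by rewrite (mulrC (b j)) eq_sym.
rewrite (minn_idPl NM); apply: eq_bigr => i _.
rewrite (bigD1 (widen_ord NM i))//= eqxx mulr1 big1 ?addr0// => j.
by rewrite -val_eqE/= eq_sym => /negbTE ->; rewrite mulr0.
Qed.

Lemma covar_sub (R : realType) d (Omega : measurableType d)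
    (P : probability Omega R) (U V : Omega -> R) :
  square_integrable P U -> square_integrable P V ->
  \int[P]_w ((U w - V w) ^+ 2) = covar P U U - 2 * covar P U V + covar P V V.
Proof.
move=> sU sV; have sUV := square_integrable_lin (-1) sV sU.
have -> : \int[P]_w ((U w - V w) ^+ 2) =
    covar P (fun w => -1 * V w + U w) (fun w => -1 * V w + U w).
  by apply: eq_Rintegral => w _; ring.
rewrite covar_linl// (covarC P V (fun _ => _)) (covarC P U (fun _ => _)).
rewrite !covar_linl// (covarC P V U); ring.
Qed.

(** A combination of the T u is an almost sure limit of elements V k of H. Each V k has the law of
    sig k * xi, which also converges pointwise; the two limits have the same cosine integrals, hence
    the same law. *)
Lemma gaussian_field_of_kernel (R : realType) d (Omega : measurableType d)
    (P : probability Omega R) (H : set (Omega -> R)) (I : Type) (K : I -> I -> R)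
    (q : nat -> I) :
  gaussian_space P H -> escaping P H -> psd_kernel K ->
  (forall u e, 0 < e -> exists i, kernel_dist K u (q i) < e) ->
  exists (T : I -> Omega -> R) (xi : Omega -> R),
    [/\ forall u, P.-integrable setT (fun w => (T u w)%:E), H xi, covar P xi xi = 1 &
        forall s : seq (R * I), eq_law P (fun w => \sum_(p <- s) p.1 * T p.2 w)
          (fun w => Num.sqrt (quad_form K s) * xi w)].
Proof.
move=> gH eH Kp dense.
have [f hf] := kernel_expansion Kp dense.
have [xi [Hxi oxi]] := orthonormal_sequence gH eH.
have sH U : H U -> square_integrable P U by case: gH => _ _ h _ _; exact: h.
pose S N u w := \sum_(j < N) f j u * xi j w.
have HS N u : H (S N u) by apply: (gaussian_space_sum _ _ gH) => j; exact: Hxi.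
have covS N M u v : covar P (S N u) (S M v) = \sum_(j < minn N M) f j u * f j v.
  rewrite covar_sum; try by move=> ?; exact/sH/Hxi.
  rewrite -(sum_orthonormal N M (f ^~ u) (f ^~ v)); apply: eq_bigr => i _; apply: eq_bigr => j _.
  by rewrite oxi.
(* The truncation level depends on u. The errors at k and k + 1 add up to at most (2^-k)^2, as
   [fast_cauchy_limit] demands, and k <= N k sends the levels to infinity. *)
have exN u : exists N : nat -> nat, forall k, (k <= N k)%N /\
    forall n, (N k <= n)%N ->
      `|K u u - \sum_(j < n) f j u * f j u| <= (2^-1 ^+ k) ^+ 2 / 2.
  have : forall k, exists N, (k <= N)%N /\ forall n, (N <= n)%N ->
      `|K u u - \sum_(j < n) f j u * f j u| <= (2^-1 ^+ k) ^+ 2 / 2.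
    move=> k; have /cvgrPdist_le/(_ ((2^-1 ^+ k) ^+ 2 / 2)) := hf u u.
    rewrite divr_gt0 ?exprn_gt0 ?invr_gt0// => /(_ isT)[N _ hN].
    by exists (maxn k N); rewrite leq_maxl; split => // n; rewrite geq_max => /andP[_ /hN].
  by move=> /choice[N hN]; exists N.
have [N hN] := choice exN.
have exT u : exists T : Omega -> R, P.-integrable setT (fun w => (T w)%:E) /\
    {ae P, forall w, S (N u k) u w @[k --> \oo] --> T w}.
  apply: fast_cauchy_limit => k; first exact: sH.
  rewrite covar_sub; [|exact: sH..]; rewrite !covS !minnn.
  have [_ /(_ _ (leqnn _)) h1] := hN u k.
  have [_ /(_ _ (leqnn _)) h2] := hN u k.+1.
  have h3 : (2^-1 ^+ k.+1) ^+ 2 / 2 <= (2^-1 ^+ k) ^+ 2 / 2 :> R.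
    rewrite [2^-1 ^+ k.+1]exprS exprMn ler_pM2r// ler_piMl ?sqr_ge0//.
    by rewrite exprn_ile1// invf_le1// ler1n.
  move: h1 h2; rewrite !ler_norml => /andP[? ?] /andP[? ?].
  (* N u need not be monotone; in either order the variance is the absolute difference of two
     partial sums. *)
  by case: (leqP (N u k.+1) (N u k)) => _; lra.
have [T hT] := choice exT.
exists T, (xi 0%N); split => // [u|s].
  by case: (hT u).
pose V k w := \sum_(p <- s) p.1 * S (N p.2 k) p.2 w.
have HV k : H (V k).
  exact: (gaussian_space_sum s (fun p => p.1) gH (fun p => HS (N p.2 k) p.2)).
have aeV : {ae P, forall w, V k w @[k --> \oo] --> \sum_(p <- s) p.1 * T p.2 w}.
  rewrite /V {V HV}; elim: s => [|p s IH].
    by apply: aeW => w; rewrite big_nil; under eq_fun do rewrite big_nil; exact: cvg_cst.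
  apply: filterS2 (hT p.2).2 IH => w h1 h2.
  rewrite big_cons; under eq_fun do rewrite big_cons.
  by apply: cvgD => //; exact: cvgMr.
(* Different points are truncated at different levels, but by orthonormality a covariance sees only
   the smaller one, which still tends to infinity. *)
have varV : covar P (V k) (V k) @[k --> \oo] --> quad_form K s.
  have covV k : covar P (V k) (V k) = \sum_(p <- s) \sum_(p' <- s)
      p.1 * p'.1 * \sum_(j < minn (N p.2 k) (N p'.2 k)) f j p.2 * f j p'.2.
    rewrite covar_sum; [|by move=> p; exact/sH/HS..].
    by apply: eq_bigr => p _; apply: eq_bigr => p' _; rewrite covS.
  rewrite (funext covV).
  apply: cvg_sum => p; apply: cvg_sum => p'; apply: cvgMr.
  apply: (cvg_comp (fun k => minn (N p.2 k) (N p'.2 k)) _ _ (hf p.2 p'.2)).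
  apply/cvgnyPge => A; exists A => // k /= Ak.
  by rewrite leq_min !(leq_trans Ak)//; [case: (hN p'.2 k)|case: (hN p.2 k)].
pose sig k := Num.sqrt (covar P (V k) (V k)).
have cvgsig : sig k @[k --> \oo] --> Num.sqrt (quad_form K s).
  by apply: (cvg_comp _ (@Num.sqrt R) varV); exact: sqrt_continuous.
have lawV k : eq_law P (V k) (fun w => sig k * xi 0%N w).
  apply: (gaussian_space_eq_law gH) => //; first exact: (gaussian_spaceZ _ gH).
  under [RHS]eq_Rintegral do rewrite exprMn.
  rewrite RintegralZl//; last exact: (sH _ (Hxi 0%N)).2.
  rewrite -covar_sqr -covar_sqr oxi mulr1 sqr_sqrtr//.
  by apply: Rintegral_ge0 => w _; rewrite -expr2 sqr_ge0.
have mxi : measurable_fun setT (xi 0%N) by exact: (sH _ (Hxi 0%N)).1.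
have mV k : measurable_fun setT (V k) by exact: (sH _ (HV k)).1.
have iT : P.-integrable setT (fun w => (\sum_(p <- s) p.1 * T p.2 w)%:E).
  under eq_fun do rewrite -sumEFin; apply: integrable_sum => // p _.
  by under eq_fun do rewrite EFinM; apply: integrableZl => //; case: (hT p.2).
apply: eq_law_of_cos => //.
  exact/square_integrable_integrable/sH/(gaussian_spaceZ _ gH).
move=> a th.
have mW : measurable_fun setT (fun w => \sum_(p <- s) p.1 * T p.2 w).
  by apply/measurable_EFinP; exact: (measurable_int P iT).
have lim1 := cvg_integral_cos (a := a) (th := th) mV mW aeV.
have lim2 : \int[P]_w cos (a * (sig k * xi 0%N w) + th) @[k --> \oo] -->
    \int[P]_w cos (a * (Num.sqrt (quad_form K s) * xi 0%N w) + th).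
  apply: cvg_integral_cos.
  - by move=> k; exact: measurable_funM.
  - exact: measurable_funM.
  - by apply: aeW => w; apply: cvgMl.
suff E : (fun k => \int[P]_w cos (a * V k w + th)) =
         (fun k => \int[P]_w cos (a * (sig k * xi 0%N w) + th)).
  by rewrite E in lim1; exact: cvg_unique lim1 lim2.
apply/funext => k.
apply: (@eq_law_Rintegral _ _ _ P _ _ (fun x => cos (a * x + th))) => //.
- exact: measurable_funM.
- apply: (measurableT_comp (continuous_measurable_fun (@continuous_cos R))).
  by apply: measurable_funD => //; exact: measurable_funM.
Qed.

(** * The generalized Cauchy covariance near the origin *)

(** With y = b ln(1 + s) the middle term is 1 - exp(- y), which lies between y / (1 + y) and y,
    while s / (1 + s) <= ln(1 + s) <= s. Both bounds are equivalent to b s near 0. *)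
Lemma one_sub_powRN_bounds (R : realType) (b s : R) : 0 < b -> 0 <= s ->
  b * s / ((1 + s) * (1 + b * s)) <= 1 - (1 + s) `^ (- b) <= b * s.
Proof.
move=> b0 s0; have s1 : 0 < 1 + s by rewrite ltr_pwDl.
have bs1 : 0 < 1 + b * s by rewrite ltr_pwDl// mulr_ge0// ltW.
pose y := b * ln (1 + s).
have -> : (1 + s) `^ (- b) = expR (- y) by rewrite /powR gt_eqF// mulNr.
have Ls : ln (1 + s) <= s by apply: le_ln1Dx; rewrite (lt_le_trans _ s0)// ltrN10.
have sL : s / (1 + s) <= ln (1 + s).
  rewrite -lerN2 -lnV ?posrE//.
  have eV : (1 + s)^-1 = 1 + - (s / (1 + s)) by field; rewrite gt_eqF.
  rewrite [X in ln X]eV.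
  apply: le_ln1Dx; rewrite ltrN2 ltr_pdivrMr// mul1r; lra.
have ys : y <= b * s by rewrite ler_pM2l.
have sy : b * (s / (1 + s)) <= y by rewrite ler_pM2l.
have y0 : 0 <= y by apply: le_trans sy; rewrite mulr_ge0 ?divr_ge0// ltW.
have y1 : 0 < 1 + y by rewrite ltr_pwDl.
apply/andP; split; last by have := expR_ge1Dx (- y); lra.
have h : expR (- y) <= (1 + y)^-1.
  by rewrite expRN lef_pV2 ?posrE ?expR_gt0// expR_ge1Dx.
apply: (@le_trans _ _ (1 - (1 + y)^-1)); last by rewrite lerD2l lerN2.
have -> : 1 - (1 + y)^-1 = y / (1 + y) by field; rewrite gt_eqF.
have -> : b * s / ((1 + s) * (1 + b * s)) = b * (s / (1 + s)) / (1 + b * s).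
  by field; rewrite !gt_eqF.
rewrite ler_pM ?invr_ge0 ?(ltW bs1)//; first by rewrite mulr_ge0 ?divr_ge0// ltW.
by rewrite lef_pV2 ?posrE// lerD2l.
Qed.

Lemma powR_sub_cvg (R : realType) (a al : R) : 0 < a -> a <= al ->
  eps `^ (al - a) @[eps --> 0^'+] --> ((al == a)%:R : R).
Proof.
move=> a0; rewrite le_eqVlt => /predU1P[->|aal].
  by rewrite subrr eqxx; under eq_fun do rewrite powRr0; exact: cvg_cst.
by rewrite gt_eqF//; apply: powR_cvg0; rewrite subr_gt0.
Qed.

(** To first order the quotient is b |x|^al eps^(al - a): coordinates whose exponent exceeds a
    disappear in the limit. *)
Lemma cauchy_factor_cvg (R : realType) (b a al x : R) :
  0 < b -> 0 < a -> a <= al ->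
  (1 - (1 + `|eps * x| `^ al) `^ (- b)) / eps `^ a @[eps --> 0^'+] -->
    b * `|x| `^ al * (al == a)%:R.
Proof.
move=> b0 a0 aal; pose c := b * `|x| `^ al.
pose s eps := eps `^ al * `|x| `^ al.
have s0 : s eps @[eps --> 0^'+] --> (0 : R).
  rewrite -[X in _ --> X](mul0r (`|x| `^ al)); apply: cvgMl.
  exact/powR_cvg0/(lt_le_trans a0).
have hp := powR_sub_cvg a0 aal.
have up : c * eps `^ (al - a) @[eps --> 0^'+] --> c * (al == a)%:R by exact: cvgMr.
have lo : c * eps `^ (al - a) / ((1 + s eps) * (1 + b * s eps)) @[eps --> 0^'+] -->
    c * (al == a)%:R.
  rewrite -[X in _ --> X](_ : c * (al == a)%:R / ((1 + 0) * (1 + b * 0)) = _); last first.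
    by rewrite mulr0 !addr0 mulr1 divr1.
  apply: cvgM => //; apply: cvgV; first by rewrite mulr0 !addr0 mulr1 oner_neq0.
  apply: cvgM; first by apply: cvgD => //; exact: cvg_cst.
  by apply: cvgD; [exact: cvg_cst|exact: cvgMr].
apply: squeeze_cvgr lo up; near=> eps.
have e0 : 0 < eps by near: eps; exact: nbhs_right_gt.
have -> : `|eps * x| `^ al = s eps.
  by rewrite normrM (gtr0_norm e0) powRM ?normr_ge0// ltW.
have se0 : 0 <= s eps by rewrite mulr_ge0 ?powR_ge0.
have ea0 : 0 < eps `^ a by exact: powR_gt0.
have E : c * eps `^ (al - a) = b * s eps / eps `^ a.
  by rewrite powRB ?(gt_eqF e0) ?implybT// /c /s; ring.
have /andP[h1 h2] := one_sub_powRN_bounds b0 se0.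
rewrite E; apply/andP; split; last by rewrite ler_pM2r ?invr_gt0.
by rewrite mulrAC ler_pM2r ?invr_gt0.
Unshelve. all: by end_near. Qed.

(** Induction on 1 - F G = (1 - F) + F (1 - G), where F tends to 1 because 1 - F is of order
    eps^a. *)
Lemma one_sub_prod_cvg (R : realType) (I : Type) (s : seq I) (a : R)
    (F : I -> R -> R) (v : I -> R) : 0 < a ->
  (forall i, (1 - F i eps) / eps `^ a @[eps --> 0^'+] --> v i) ->
  (1 - \prod_(i <- s) F i eps) / eps `^ a @[eps --> 0^'+] --> \sum_(i <- s) v i.
Proof.
move=> a0 Fv; elim: s => [|i s IH].
  by rewrite big_nil; under eq_fun do rewrite big_nil subrr mul0r; exact: cvg_cst.
have F1 : F i eps @[eps --> 0^'+] --> (1 : R).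
  have h : 1 - eps `^ a * ((1 - F i eps) / eps `^ a) @[eps --> 0^'+] -->
      (1 - 0 * v i : R).
    by apply: cvgB; [exact: cvg_cst|apply: cvgM => //; exact: powR_cvg0].
  rewrite mul0r subr0 in h; apply: cvg_trans h; apply: near_eq_cvg; near=> eps.
  have e0 : 0 < eps by near: eps; exact: nbhs_right_gt.
  by field; rewrite gt_eqF// powR_gt0.
rewrite big_cons.
have : (1 - F i eps) / eps `^ a +
    F i eps * ((1 - \prod_(i <- s) F i eps) / eps `^ a) @[eps --> 0^'+] -->
    v i + 1 * \sum_(i <- s) v i.
  by apply: cvgD => //; exact: cvgM.
rewrite mul1r; apply: cvg_trans; apply: near_eq_cvg; apply: nearW => eps.
by rewrite big_cons; ring.
Unshelve. all: by end_near. Qed.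

Definition cauchy_cov (R : realType) (n : nat) (alpha beta : 'I_n -> R)
    (tau : 'rV[R]_n) : R :=
  \prod_(i < n) (1 + `|tau ord0 i| `^ alpha i) `^ (- beta i).

(** The semivariogram of the tangent field, half the variance of T u - T 0. Selecting coordinates by
    [alpha i == a] keeps the limit theorems independent of any ordering of the exponents. *)
Definition cauchy_variogram (R : realType) (n : nat) (alpha beta : 'I_n -> R) (a : R)
    (u : 'rV[R]_n) : R :=
  \sum_(i < n) beta i * `|u ord0 i| `^ alpha i * (alpha i == a)%:R.

Lemma cauchy_cov_cvg (R : realType) (n : nat) (alpha beta : 'I_n -> R) (a : R)
    (u : 'rV[R]_n) :
  0 < a -> (forall i, a <= alpha i) -> (forall i, 0 < beta i) ->
  (1 - cauchy_cov alpha beta (eps *: u)) / eps `^ a @[eps --> 0^'+] -->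
    cauchy_variogram alpha beta a u.
Proof.
move=> a0 aal b0.
pose F (i : 'I_n) (eps : R) : R := (1 + `|eps * u ord0 i| `^ alpha i) `^ (- beta i).
have E eps : cauchy_cov alpha beta (eps *: u) = \prod_(i <- index_enum 'I_n) F i eps.
  by apply: eq_bigr => i _; rewrite mxE.
under eq_fun do rewrite E.
apply: (one_sub_prod_cvg (F := F)) => // i.
exact: (cauchy_factor_cvg (x := u ord0 i) (b0 i) a0 (aal i)).
Qed.

Lemma cauchy_covN (R : realType) (n : nat) (alpha beta : 'I_n -> R) (u : 'rV[R]_n) :
  cauchy_cov alpha beta (- u) = cauchy_cov alpha beta u.
Proof. by apply: eq_bigr => i _; rewrite mxE normrN. Qed.

Lemma cauchy_cov0 (R : realType) (n : nat) (alpha beta : 'I_n -> R) :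
  (forall i, 0 < alpha i) -> cauchy_cov alpha beta 0 = 1.
Proof.
move=> al0; rewrite /cauchy_cov big1// => i _.
by rewrite mxE normr0 powR0 ?gt_eqF// addr0 powR1.
Qed.

Lemma cauchy_variogramN (R : realType) (n : nat) (alpha beta : 'I_n -> R) (a : R)
    (u : 'rV[R]_n) :
  cauchy_variogram alpha beta a (- u) = cauchy_variogram alpha beta a u.
Proof. by apply: eq_bigr => i _; rewrite mxE normrN. Qed.

Lemma cauchy_variogram0 (R : realType) (n : nat) (alpha beta : 'I_n -> R) (a : R) :
  (forall i, 0 < alpha i) -> cauchy_variogram alpha beta a 0 = 0.
Proof.
move=> al0; rewrite /cauchy_variogram big1// => i _.
by rewrite mxE normr0 powR0 ?(gt_eqF (al0 i))// mulr0 mul0r.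
Qed.

Lemma powRN_cvg0_at_infty (R : realType) (al b t : R) : 0 < al -> 0 < b ->
  (1 + `|t - n%:R| `^ al) `^ (- b) @[n --> \oo] --> (0 : R).
Proof.
move=> al0 b0; apply/cvgr0Pnorm_le => e e0.
(* Thresholds solving A^(-b) = e and B^al = A. *)
pose A := e `^ (- b^-1); pose B := A `^ al^-1.
near=> n.
have hn : B <= `|t - n%:R|.
  have : `|t| + B <= n%:R by near: n; exact: nbhs_infty_ger.
  have := ler_normB t (t - n%:R); rewrite opprB addrC subrK normr_nat; lra.
have h1 : A <= 1 + `|t - n%:R| `^ al.
  have -> : A = B `^ al by rewrite /B -powRrM mulVf ?gt_eqF// powRr1// powR_ge0.
  have : B `^ al <= `|t - n%:R| `^ al.
    by apply: ge0_ler_powR => //; rewrite ?nnegrE ?powR_ge0 ?ltW.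
  by lra.
have A0 : 0 < A by exact: powR_gt0.
have h2 : 0 < 1 + `|t - n%:R| `^ al by exact: lt_le_trans h1.
rewrite ger0_norm ?powR_ge0// powRN.
have -> : e = (A `^ b)^-1.
  by rewrite -powRN /A -powRrM mulrNN mulVf ?gt_eqF// powRr1// ltW.
rewrite lef_pV2 ?posrE ?powR_gt0//.
by rewrite ge0_ler_powR ?nnegrE// ltW.
Unshelve. all: by end_near. Qed.

Lemma cauchy_cov_escape (R : realType) (n : nat) (alpha beta : 'I_n -> R) (i0 : 'I_n)
    (t : 'rV[R]_n) :
  (forall i, 0 < alpha i) -> (forall i, 0 < beta i) ->
  cauchy_cov alpha beta (t - k%:R *: delta_mx ord0 i0) @[k --> \oo] --> 0.
Proof.
move=> al0 b0.
apply: (squeeze_cvgr _ (cvg_cst 0)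
  (powRN_cvg0_at_infty (t ord0 i0) (al0 i0) (b0 i0))).
apply: nearW => k; rewrite prodr_ge0 => [|i _]; last exact: powR_ge0.
rewrite /= /cauchy_cov (bigD1 i0)//= !mxE !eqxx mulr1.
rewrite -[leRHS]mulr1 ler_wpM2l ?powR_ge0//.
apply: prodr_ile1 => i _; rewrite powR_ge0/=.
have h : 1 <= 1 + `|(t - k%:R *: delta_mx ord0 i0) ord0 i| `^ alpha i.
  by rewrite lerDl powR_ge0.
by rewrite -[leRHS](powRr0 (1 + `|(t - k%:R *: delta_mx ord0 i0) ord0 i| `^ alpha i)) ler_powR// oppr_le0 ltW.
Qed.

(** * Increments of the Gaussian sheet *)

Definition field_span (R : realType) (I : Type) d (Omega : measurableType d)
    (X : I -> Omega -> R) : set (Omega -> R) :=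
  [set U | exists s : seq (R * I), U = fun w => \sum_(p <- s) p.1 * X p.2 w].

(** The lag tau = 0 in the covariance identity says that the second moment is finite. *)
Lemma gsgcc_square_integrable (R : realType) (n : nat) (alpha beta : 'I_n -> R)
    d (Omega : measurableType d) (P : probability Omega R)
    (X : 'rV[R]_n -> {RV P >-> R}) (t : 'rV[R]_n) :
  gsgcc alpha beta X -> square_integrable P (X t).
Proof.
move=> [_ /(_ t 0)]; rewrite addr0 unlock => h; split=> //.
have mX2 : measurable_fun setT (fun w => X t w ^+ 2) by exact: measurable_funX.
apply/integrableP; split; first exact/measurable_EFinP.
under eq_integral do rewrite gee0_abs ?lee_fin ?sqr_ge0//.
by rewrite h ltry.
Qed.

Lemma gsgcc_covar (R : realType) (n : nat) (alpha beta : 'I_n -> R)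
    d (Omega : measurableType d) (P : probability Omega R)
    (X : 'rV[R]_n -> {RV P >-> R}) (s t : 'rV[R]_n) :
  gsgcc alpha beta X -> covar P (X s) (X t) = cauchy_cov alpha beta (s - t).
Proof.
by move=> [_ /(_ t (s - t))]; rewrite addrC subrK unlock /covar /Rintegral => ->.
Qed.

Lemma Rintegral_sum_mean0 (R : realType) d (Omega : measurableType d)
    (P : probability Omega R) (I : Type) (s : seq (R * I)) (X : I -> Omega -> R) :
  (forall i, square_integrable P (X i)) -> (forall i, \int[P]_w X i w = 0) ->
  \int[P]_w (\sum_(p <- s) p.1 * X p.2 w) = 0.
Proof.
move=> sX X0; elim: s => [|p s IH].
  by under eq_Rintegral do rewrite big_nil; rewrite Rintegral_cst// mul0r.
under eq_Rintegral do rewrite big_cons.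
rewrite Rintegral_lin ?IH ?X0 ?mulr0 ?addr0//; apply: square_integrable_integrable => //.
exact: (square_integrable_sum s (fun p => p.1) (fun p => sX p.2)).
Qed.

Lemma gsgcc_gaussian_space (R : realType) (n : nat) (alpha beta : 'I_n -> R)
    d (Omega : measurableType d) (P : probability Omega R)
    (X : 'rV[R]_n -> {RV P >-> R}) :
  gsgcc alpha beta X -> gaussian_space P (field_span (fun t => X t : Omega -> R)).
Proof.
move=> gX; have sX t := gsgcc_square_integrable t gX.
split.
- by exists [::]; apply/funext => w; rewrite big_nil.
- move=> a _ _ [s ->] [t ->]; exists ([seq (a * p.1, p.2) | p <- s] ++ t).
  apply/funext => w; rewrite big_cat big_map/= mulr_sumr; congr (_ + _).
  by apply: eq_bigr => p _; rewrite mulrA.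
- by move=> _ [s ->]; exact: (square_integrable_sum s (fun p => p.1) (fun p => sX p.2)).
- move=> _ [s ->]; apply: (Rintegral_sum_mean0 s (X := fun t => X t : Omega -> R)) => // t.
  by case: gX => -[_ /(_ t)]; rewrite unlock /Rintegral => ->.
- move=> _ [s ->]; case: gX => -[gX _] _.
  have [m [v h]] := gX (size s) (fun j => (tnth (in_tuple s) j).2)
    (fun j => (tnth (in_tuple s) j).1).
  exists m, v => A mA; rewrite -h//; congr (P (_ @^-1` A)).
  by apply/funext => w; rewrite [LHS]big_tnth.
Qed.

Lemma gsgcc_escaping (R : realType) (n : nat) (i0 : 'I_n) (alpha beta : 'I_n -> R)
    d (Omega : measurableType d) (P : probability Omega R)
    (X : 'rV[R]_n -> {RV P >-> R}) :
  (forall i, 0 < alpha i) -> (forall i, 0 < beta i) ->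
  gsgcc alpha beta X -> escaping P (field_span (fun t => X t : Omega -> R)).
Proof.
move=> al0 b0 gX; have sX t := gsgcc_square_integrable t gX.
exists (fun k => X (k%:R *: delta_mx ord0 i0) : Omega -> R); split.
- move=> k; exists [:: (1, k%:R *: delta_mx ord0 i0)].
  by apply/funext => w; rewrite big_seq1 mul1r.
- by move=> k; rewrite (gsgcc_covar _ _ gX) subrr cauchy_cov0.
- move=> _ [s ->].
  suff : \sum_(p <- s) p.1 * cauchy_cov alpha beta (p.2 - k%:R *: delta_mx ord0 i0)
      @[k --> \oo] --> \sum_(p <- s) p.1 * 0.
    rewrite big1 => [|p _]; last by rewrite mulr0.
    apply: cvg_trans; apply: near_eq_cvg; apply: nearW => k.
    rewrite (covar_suml s (fun p => p.1) (fun p => sX p.2))//.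
    by apply: eq_bigr => p _; rewrite (gsgcc_covar _ _ gX).
  by apply: cvg_sum => p; apply: cvgMr; exact: cauchy_cov_escape.
Qed.

Definition rescaled_increment (R : realType) (n : nat) d (Omega : measurableType d)
    (P : probability Omega R) (X : 'rV[R]_n -> {RV P >-> R}) (t0 : 'rV[R]_n)
    (kappa eps : R) (u : 'rV[R]_n) (w : Omega) : R :=
  eps `^ (- kappa) * (X (t0 + eps *: u) w - X t0 w).

Definition tangent_kernel (R : realType) (n : nat) (alpha beta : 'I_n -> R) (a : R)
    (u v : 'rV[R]_n) : R :=
  cauchy_variogram alpha beta a u + cauchy_variogram alpha beta a v -
  cauchy_variogram alpha beta a (u - v).

Lemma rescaled_increment_span (R : realType) (n : nat) d (Omega : measurableType d)
    (P : probability Omega R) (X : 'rV[R]_n -> {RV P >-> R}) (t0 : 'rV[R]_n)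
    (kappa eps : R) (u : 'rV[R]_n) :
  rescaled_increment X t0 kappa eps u = fun w =>
    \sum_(p <- [:: (eps `^ (- kappa), t0 + eps *: u); (- eps `^ (- kappa), t0)])
      p.1 * X p.2 w.
Proof.
apply/funext => w; rewrite /rescaled_increment big_cons big_seq1/=; ring.
Qed.

Lemma rescaled_increment_covar (R : realType) (n : nat) (alpha beta : 'I_n -> R)
    d (Omega : measurableType d) (P : probability Omega R)
    (X : 'rV[R]_n -> {RV P >-> R}) (t0 u v : 'rV[R]_n) (a eps : R) :
  (forall i, 0 < alpha i) -> 0 < eps -> gsgcc alpha beta X ->
  covar P (rescaled_increment X t0 (a / 2) eps u) (rescaled_increment X t0 (a / 2) eps v) =
  (1 - cauchy_cov alpha beta (eps *: u)) / eps `^ a +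
  (1 - cauchy_cov alpha beta (eps *: v)) / eps `^ a -
  (1 - cauchy_cov alpha beta (eps *: (u - v))) / eps `^ a.
Proof.
move=> al0 e0 gX; have sX t := gsgcc_square_integrable t gX.
rewrite !rescaled_increment_span.
rewrite (covar_sum _ _ (fun p => p.1) (fun p => p.1) (fun p => sX p.2) (fun p => sX p.2)).
rewrite !big_cons !big_nil /=.
rewrite 4!(gsgcc_covar _ _ gX).
have -> : t0 + eps *: u - (t0 + eps *: v) = eps *: (u - v).
  by rewrite opprD addrACA subrr add0r scalerBr.
have -> : t0 + eps *: u - t0 = eps *: u by rewrite addrC addKr.
have -> : t0 - (t0 + eps *: v) = - (eps *: v) by rewrite opprD addrA subrr add0r.
rewrite subrr cauchy_covN cauchy_cov0//.
have -> : eps `^ a = eps `^ (a / 2) ^+ 2.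
  by rewrite expr2 -powRD ?(gt_eqF e0) ?implybT// -splitr.
have h0 : eps `^ (a / 2) != 0 by rewrite gt_eqF// powR_gt0.
rewrite powRN; move: (eps `^ (a / 2)) h0 => c c0.
move: (cauchy_cov alpha beta (eps *: (u - v))) (cauchy_cov alpha beta (eps *: u))
  (cauchy_cov alpha beta (eps *: v)) => x y z.
by field.
Qed.

Lemma rescaled_increment_covar_cvg (R : realType) (n : nat) (alpha beta : 'I_n -> R)
    d (Omega : measurableType d) (P : probability Omega R)
    (X : 'rV[R]_n -> {RV P >-> R}) (t0 u v : 'rV[R]_n) (a : R) :
  0 < a -> (forall i, a <= alpha i) -> (forall i, 0 < beta i) -> gsgcc alpha beta X ->
  covar P (rescaled_increment X t0 (a / 2) eps u) (rescaled_increment X t0 (a / 2) eps v)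
    @[eps --> 0^'+] --> tangent_kernel alpha beta a u v.
Proof.
move=> a0 aal b0 gX; have al0 i : 0 < alpha i by exact: lt_le_trans (aal i).
have h w := cauchy_cov_cvg (u := w) a0 aal b0.
pose f w eps := (1 - cauchy_cov alpha beta (eps *: w)) / eps `^ a.
have : f u eps + f v eps - f (u - v) eps @[eps --> 0^'+] -->
    tangent_kernel alpha beta a u v.
  by apply: cvgB; [apply: cvgD|]; exact: h.
apply: cvg_trans; apply: near_eq_cvg; near=> eps.
by rewrite (rescaled_increment_covar _ _ _ _ al0 _ gX).
Unshelve. all: by end_near. Qed.

Lemma sum_rescaled_increment_cvg (R : realType) (n : nat) (alpha beta : 'I_n -> R)
    d (Omega : measurableType d) (P : probability Omega R)
    (X : 'rV[R]_n -> {RV P >-> R}) (t0 : 'rV[R]_n) (a : R) (s : seq (R * 'rV[R]_n)) :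
  0 < a -> (forall i, a <= alpha i) -> (forall i, 0 < beta i) -> gsgcc alpha beta X ->
  let U eps w := \sum_(p <- s) p.1 * rescaled_increment X t0 (a / 2) eps p.2 w in
  covar P (U eps) (U eps) @[eps --> 0^'+] --> quad_form (tangent_kernel alpha beta a) s.
Proof.
move=> a0 aal b0 gX U; have gH := gsgcc_gaussian_space gX.
have sY eps u : square_integrable P (rescaled_increment X t0 (a / 2) eps u).
  by case: gH => _ _ + _ _; apply; rewrite rescaled_increment_span; eexists.
have E eps : covar P (U eps) (U eps) = \sum_(p <- s) \sum_(q <- s) p.1 * q.1 *
    covar P (rescaled_increment X t0 (a / 2) eps p.2) (rescaled_increment X t0 (a / 2) eps q.2).
  exact: (covar_sum s s (fun p => p.1) (fun p => p.1) (fun p => sY eps p.2) (fun p => sY eps p.2)).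
rewrite (funext E); apply: cvg_sum => p; apply: cvg_sum => q; apply: cvgMr.
exact: rescaled_increment_covar_cvg.
Qed.

(** Positivity is inherited from the sheet: the quadratic form is a limit of variances of
    combinations of rescaled increments at the origin. *)
Lemma psd_tangent_kernel (R : realType) (n : nat) (alpha beta : 'I_n -> R)
    d (Omega : measurableType d) (P : probability Omega R)
    (X : 'rV[R]_n -> {RV P >-> R}) (a : R) :
  0 < a -> (forall i, a <= alpha i) -> (forall i, 0 < beta i) -> gsgcc alpha beta X ->
  psd_kernel (tangent_kernel alpha beta a).
Proof.
move=> a0 aal b0 gX; split=> [u v|s].
  by rewrite /tangent_kernel -(cauchy_variogramN _ _ _ (u - v)) opprB [X in X - _ = _]addrC.
have h := sum_rescaled_increment_cvg (s := s) 0 a0 aal b0 gX.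
rewrite -(cvg_lim _ h)//; apply: limr_ge; first by apply/cvg_ex; eexists; exact: h.
apply: nearW => eps; apply: Rintegral_ge0 => w _; rewrite -expr2; exact: sqr_ge0.
Qed.

Lemma tangent_kernel_dist (R : realType) (n : nat) (alpha beta : 'I_n -> R) (a : R)
    (u v : 'rV[R]_n) : (forall i, 0 < alpha i) ->
  kernel_dist (tangent_kernel alpha beta a) u v = 2 * cauchy_variogram alpha beta a (u - v).
Proof.
move=> al0; rewrite /kernel_dist /tangent_kernel !subrr cauchy_variogram0//; ring.
Qed.

Lemma tangent_kernel_separable (R : realType) (n : nat) (alpha beta : 'I_n -> R) (a : R) :
  (forall i, 0 < alpha i) -> (forall i, 0 < beta i) ->
  exists q : nat -> 'rV[R]_n, forall u e, 0 < e ->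
    exists i, kernel_dist (tangent_kernel alpha beta a) u (q i) < e.
Proof.
move=> al0 b0.
exists (fun i => map_mx ratr (odflt 0 (unpickle i : option 'rV[rat]_n))) => u e e0.
(* The distance is twice the variogram, which has n terms of size at most c; n + 1 in the
   denominator gives the strict bound n c < e / 2. *)
pose c := e / (2 * n.+1%:R).
have c0 : 0 < c by rewrite divr_gt0// mulr_gt0.
have ex : forall i : 'I_n, exists r : rat,
    beta i * `|u ord0 i - ratr r| `^ alpha i <= c.
  move=> i; pose eta := (c / beta i) `^ (alpha i)^-1.
  have eta0 : 0 < eta by rewrite powR_gt0// divr_gt0.
  have : u ord0 i < u ord0 i + eta by rewrite ltrDl.
  move=> /rat_in_itvoo[r]; rewrite in_itv/= => /andP[r1 r2]; exists r.
  rewrite mulrC -ler_pdivlMr//.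
  have -> : c / beta i = eta `^ alpha i.
    by rewrite /eta -powRrM mulVf ?gt_eqF// powRr1// divr_ge0 ?ltW.
  apply: ge0_ler_powR; rewrite ?nnegrE ?(ltW (al0 i)) ?(ltW eta0)//.
  by rewrite ltr0_norm ?subr_lt0// opprB lerBlDl ltW.
have [r hr] := choice ex.
exists (pickle (\row_i r i)); rewrite pickleK/= tangent_kernel_dist//.
have : cauchy_variogram alpha beta a (u - map_mx ratr (\row_i r i)) <= \sum_(i < n) c.
  apply: ler_sum => i _; rewrite !mxE.
  apply: le_trans (hr i); rewrite ler_piMr ?mulr_ge0 ?powR_ge0 ?(ltW (b0 i))//.
  by case: (_ == _).
rewrite sumr_const card_ord -[c *+ n]mulr_natr => h.
have : c * n%:R < e / 2.
  have n0 : n.+1%:R != 0 :> R by rewrite pnatr_eq0.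
  have -> : c * n%:R = e / 2 * (n%:R / n.+1%:R).
    by rewrite /c; move: (n.+1%:R : R) n0 => N N0; field.
  by rewrite gtr_pMr ?divr_gt0// ltr_pdivrMr// mul1r ltr_nat.
lra.
Qed.

(** * The tangent field *)

(* Every linear combination of T has the law of a multiple of one fixed standard
   element xi of H; this determines all finite-dimensional laws. *)
Definition kernel_field (R : realType) d (Omega : measurableType d)
    (P : probability Omega R) (H : set (Omega -> R)) (I : Type) (K : I -> I -> R)
    (xi : Omega -> R) (T : I -> Omega -> R) : Prop :=
  [/\ forall u, P.-integrable setT (fun w => (T u w)%:E), H xi, covar P xi xi = 1 &
      forall s : seq (R * I), eq_law P (fun w => \sum_(p <- s) p.1 * T p.2 w)
        (fun w => Num.sqrt (quad_form K s) * xi w)].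

Lemma kernel_field_measurable (R : realType) d (Omega : measurableType d)
    (P : probability Omega R) (H : set (Omega -> R)) (I : Type) (K : I -> I -> R)
    (xi : Omega -> R) (T : I -> Omega -> R) (s : seq (R * I)) :
  kernel_field P H K xi T -> measurable_fun setT (fun w => \sum_(p <- s) p.1 * T p.2 w).
Proof.
move=> [iT _ _ _]; apply: measurable_sum => p; apply: measurable_funM => //.
by apply/measurable_EFinP; exact: (measurable_int P (iT p.2)).
Qed.

Lemma kernel_field_mean (R : realType) d (Omega : measurableType d)
    (P : probability Omega R) (H : set (Omega -> R)) (I : Type) (K : I -> I -> R)
    (xi : Omega -> R) (T : I -> Omega -> R) (u : I) :
  gaussian_space P H -> kernel_field P H K xi T -> \int[P]_w T u w = 0.
Proof.
move=> gH kT; have [_ _ H2 H0 _] := gH; have [_ Hxi _ law] := kT.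
have mT := kernel_field_measurable [:: (1, u)] kT.
have mxi : measurable_fun setT (fun w => Num.sqrt (quad_form K [:: (1, u)]) * xi w).
  by apply: measurable_funM => //; exact: (H2 _ Hxi).1.
have := eq_law_Rintegral mT mxi (law _) (@measurable_id _ _ setT).
under eq_Rintegral do rewrite big_seq1 mul1r.
by move=> ->; exact: H0 _ (gaussian_spaceZ _ gH Hxi).
Qed.

Lemma kernel_field_sum_square_integrable (R : realType) d (Omega : measurableType d)
    (P : probability Omega R) (H : set (Omega -> R)) (I : Type) (K : I -> I -> R)
    (xi : Omega -> R) (T : I -> Omega -> R) (s : seq (R * I)) :
  gaussian_space P H -> kernel_field P H K xi T ->
  square_integrable P (fun w => \sum_(p <- s) p.1 * T p.2 w).
Proof.
move=> gH kT; have [_ _ H2 H0 _] := gH; have [_ Hxi _ law] := kT.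
have mT := kernel_field_measurable s kT.
have sxi := H2 _ (gaussian_spaceZ (Num.sqrt (quad_form K s)) gH Hxi).
split => //; apply/integrableP; split.
  by apply/measurable_EFinP; exact: measurable_funX.
have mg : measurable_fun setT (fun x : R => `|(x ^+ 2)%:E|%E).
  by apply: measurableT_comp => //; apply/measurable_EFinP; exact: measurable_funX.
rewrite (eq_law_integral mT sxi.1 (law s) mg).
by have /integrableP[] := sxi.2.
Qed.

Lemma kernel_field_sqr (R : realType) d (Omega : measurableType d)
    (P : probability Omega R) (H : set (Omega -> R)) (I : Type) (K : I -> I -> R)
    (xi : Omega -> R) (T : I -> Omega -> R) (s : seq (R * I)) :
  gaussian_space P H -> psd_kernel K -> kernel_field P H K xi T ->
  \int[P]_w ((\sum_(p <- s) p.1 * T p.2 w) ^+ 2) = quad_form K s.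
Proof.
move=> gH [_ Kp] kT; have [_ _ H2 H0 _] := gH; have [_ Hxi xi1 law] := kT.
have mT := kernel_field_measurable s kT.
have sxi := H2 _ (gaussian_spaceZ (Num.sqrt (quad_form K s)) gH Hxi).
have mg : measurable_fun setT (fun x : R => x ^+ 2) by [].
rewrite (eq_law_Rintegral mT sxi.1 (law s) mg).
under eq_Rintegral do rewrite exprMn.
rewrite RintegralZl//; last exact: (H2 _ Hxi).2.
by rewrite -covar_sqr xi1 mulr1 sqr_sqrtr.
Qed.

Lemma kernel_field_square_integrable (R : realType) d (Omega : measurableType d)
    (P : probability Omega R) (H : set (Omega -> R)) (I : Type) (K : I -> I -> R)
    (xi : Omega -> R) (T : I -> Omega -> R) (u : I) :
  gaussian_space P H -> kernel_field P H K xi T -> square_integrable P (T u).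
Proof.
move=> gH kT; have := kernel_field_sum_square_integrable [:: (1, u)] gH kT.
by congr square_integrable; apply/funext => w; rewrite big_seq1 mul1r.
Qed.

Lemma kernel_field_covar (R : realType) d (Omega : measurableType d)
    (P : probability Omega R) (H : set (Omega -> R)) (I : Type) (K : I -> I -> R)
    (xi : Omega -> R) (T : I -> Omega -> R) (u v : I) :
  gaussian_space P H -> psd_kernel K -> kernel_field P H K xi T ->
  covar P (T u) (T v) = K u v.
Proof.
move=> gH Kp kT; have [Ks _] := Kp.
have sT t := kernel_field_square_integrable t gH kT.
have E s : quad_form (fun u v => covar P (T u) (T v)) s = quad_form K s.
  rewrite -(kernel_field_sqr s gH Kp kT) -covar_sqr.
  by rewrite (covar_sum s s (fun p => p.1) (fun p => p.1) (fun p => sT p.2) (fun p => sT p.2)).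
(* Polarisation: the quadratic forms at u, at v and at u + v determine the covariance. *)
have := E [:: (1, u); (1, v)]; have := E [:: (1, u)]; have := E [:: (1, v)].
rewrite /quad_form !big_cons !big_nil/= (covarC P (T v) (T u)) (Ks v u).
by move=> h1 h2 h3; lra.
Qed.

Lemma kernel_field_gaussian (R : realType) (n : nat) d (Omega : measurableType d)
    (P : probability Omega R) (H : set (Omega -> R)) (K : 'rV[R]_n -> 'rV[R]_n -> R)
    (xi : Omega -> R) (T : 'rV[R]_n -> {RV P >-> R}) :
  gaussian_space P H -> kernel_field P H K xi (fun u => T u : Omega -> R) ->
  centered_gaussian_field T.
Proof.
move=> gH kT; split=> [k t c|t].
  have [_ _ _ _ Hlaw] := gH; have [_ Hxi _ law] := kT.
  pose s := [seq (c j, t j) | j <- index_enum 'I_k].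
  have [m [v h]] := Hlaw _ (gaussian_spaceZ (Num.sqrt (quad_form K s)) gH Hxi).
  exists m, v => A mA; rewrite -h// -law//; congr (P (_ @^-1` A)).
  by apply/funext => w; rewrite big_map.
have fin : (\int[P]_w (T t w)%:E)%E \is a fin_num.
  by apply: integrable_fin_num => //; case: kT.
rewrite unlock.
exact: (etrans (esym (fineK fin)) (f_equal EFin (kernel_field_mean t gH kT))).
Qed.

(** U eps may be replaced by sqrt(var) xi, which has the same law and converges at every sample
    point as the variance does. *)
Lemma cvg_integral_cos_gaussian (R : realType) d (Omega : measurableType d)
    (P : probability Omega R) (H : set (Omega -> R)) (xi W : Omega -> R)
    (U : R -> Omega -> R) (v th : R) :
  gaussian_space P H -> H xi -> covar P xi xi = 1 -> (forall eps, H (U eps)) ->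
  covar P (U eps) (U eps) @[eps --> 0^'+] --> v -> measurable_fun setT W ->
  eq_law P W (fun w => Num.sqrt v * xi w) ->
  \int[P]_w cos (U eps w + th) @[eps --> 0^'+] --> \int[P]_w cos (W w + th).
Proof.
move=> gH Hxi xi1 HU Uv mW law; have [_ _ H2 _ _] := gH.
have mxi : measurable_fun setT xi by exact: (H2 _ Hxi).1.
have mxic c : measurable_fun setT (fun w => c * xi w) by exact: measurable_funM.
have mcos : measurable_fun setT (fun x : R => cos (x + th)).
  apply: (measurableT_comp (continuous_measurable_fun (@continuous_cos R))).
  exact: measurable_funD.
rewrite (eq_law_Rintegral mW (mxic _) law mcos).
have lawU eps : eq_law P (U eps) (fun w => Num.sqrt (covar P (U eps) (U eps)) * xi w).
  apply: (gaussian_space_eq_law gH) => //; first exact: (gaussian_spaceZ _ gH).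
  under [RHS]eq_Rintegral do rewrite exprMn.
  rewrite RintegralZl//; last exact: (H2 _ Hxi).2.
  rewrite -covar_sqr -covar_sqr xi1 mulr1 sqr_sqrtr//.
  by apply: Rintegral_ge0 => w _; rewrite -expr2 sqr_ge0.
have E eps : \int[P]_w cos (U eps w + th) =
    \int[P]_w cos (1 * (Num.sqrt (covar P (U eps) (U eps)) * xi w) + th).
  under [RHS]eq_Rintegral do rewrite mul1r.
  exact: (eq_law_Rintegral (H2 _ (HU eps)).1 (mxic _) (lawU eps) mcos).
rewrite (funext E).
under eq_Rintegral do rewrite -[_ * xi _]mul1r.
(* Dominated convergence is sequential, so the limit eps -> 0+ is tested along sequences. *)
apply/cvg_at_rightP => e [e0 ecvg].
apply: (@cvg_integral_cos _ _ _ P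
  (fun k w => Num.sqrt (covar P (U (e k)) (U (e k))) * xi w)) => //.
apply: aeW => w; apply: cvgMl.
have /cvg_at_rightP/(_ e (conj e0 ecvg)) h := Uv.
by apply: (cvg_comp _ (@Num.sqrt R) h); exact: sqrt_continuous.
Qed.

(** Since c j >= 1, a second moment at most c j is at most (c j)^2, so [l1_le_of_l2] bounds the
    first absolute moment by c j. *)
Lemma l1_bounded_of_sqr (R : realType) d (Omega : measurableType d)
    (P : probability Omega R) (k : nat) (c : 'I_k -> R) (Y : 'I_k -> Omega -> R) :
  (forall j, square_integrable P (Y j)) ->
  (forall j, 1 <= c j) -> (forall j, \int[P]_w (Y j w ^+ 2) <= c j) ->
  l1_bounded P (\sum_j c j) (fun w => \row_j Y j w).
Proof.
move=> sY c1 Yc.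
have iY j := square_integrable_integrable (sY j).
split=> [j|]; first by under eq_fun do rewrite mxE; exact: iY.
under eq_Rintegral do (under eq_bigr do rewrite mxE).
have bound j : \int[P]_w `|Y j w| <= c j.
  have c0 : 0 < c j by exact: lt_le_trans (c1 j).
  by apply: l1_le_of_l2 => //; rewrite (le_trans (Yc j))// expr2 ler_peMl// ltW.
have iN j : P.-integrable setT (fun w => `|Y j w|%:E) by exact: (integrable_abse (iY j)).
suff -> : \int[P]_w (\sum_j `|Y j w|) = \sum_j \int[P]_w `|Y j w|.
  exact: ler_sum.
elim: (index_enum _) => [|j s IH].
  by under eq_Rintegral do rewrite big_nil; rewrite Rintegral_cst// mul0r big_nil.
under eq_Rintegral do rewrite big_cons.
have iS : P.-integrable setT (fun w => (\sum_(j <- s) `|Y j w|)%:E).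
  by under eq_fun do rewrite -sumEFin; apply: integrable_sum => // j' _; exact: iN.
rewrite big_cons -IH; exact: (RintegralD measurableT (iN j) iS).
Qed.

Lemma kernel_field_cvg_fdd (R : realType) (n : nat) d (Omega : measurableType d)
    (P : probability Omega R) (H : set (Omega -> R)) (K : 'rV[R]_n -> 'rV[R]_n -> R)
    (xi : Omega -> R) (Y : R -> 'rV[R]_n -> Omega -> R) (T : 'rV[R]_n -> {RV P >-> R}) :
  gaussian_space P H -> psd_kernel K ->
  kernel_field P H K xi (fun u => T u : Omega -> R) ->
  (forall eps u, H (Y eps u)) ->
  (forall u v, covar P (Y eps u) (Y eps v) @[eps --> 0^'+] --> K u v) ->
  cvg_fdd P Y P T.
Proof.
move=> gH Kp kT HY YK k u f cf [B fB]; have [_ _ H2 _ _] := gH.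
have [_ Hxi xi1 law] := kT.
(* The extra 1 leaves room for variances close to their limit K and ensures c j >= 1. *)
pose c j := 1 + K (u j) (u j).
have c1 j : 1 <= c j by rewrite lerDl; exact: psd_diag.
have lT : l1_bounded P (\sum_j c j) (fd_vector (fun u => T u : Omega -> R) u).
  apply: l1_bounded_of_sqr => // j.
    exact: (kernel_field_square_integrable (u j) gH kT).
  by rewrite -covar_sqr (kernel_field_covar _ _ gH Kp kT) /c lerDr.
have lY : \forall eps \near 0^'+, l1_bounded P (\sum_j c j) (fd_vector (Y eps) u).
  have near1 j : \forall eps \near 0^'+, covar P (Y eps (u j)) (Y eps (u j)) <= c j.
    have /cvgrPdist_le/(_ 1 ltr01) := YK (u j) (u j).
    by apply: filterS => eps; rewrite ler_norml /c => /andP[h1 h2]; lra.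
  have : \forall eps \near 0^'+, forall j, covar P (Y eps (u j)) (Y eps (u j)) <= c j.
    exact: filter_forall.
  apply: filterS => eps Yc.
  by apply: l1_bounded_of_sqr => // j; exact/H2/HY.
have lim := @cvg_integral_of_cos _ _ _ P k (\sum_j c j) _ (0^'+)
  (fun eps => fd_vector (Y eps) u) (fd_vector (fun u => T u : Omega -> R) u) _ lY lT _ f B cf fB.
have fin (Z : Omega -> 'rV[R]_k) : measurable_coords Z ->
    'E_P[fun w => f (Z w)]%E = (\int[P]_w f (Z w))%:E.
  move=> mZ; rewrite unlock /Rintegral fineK//; apply: integrable_fin_num => //.
  exact: bounded_integrable (measurable_continuous_coords mZ cf fB) (fun w => fB (Z w)).
rewrite fin; last exact: l1_bounded_coords lT.
have -> : (fun eps => 'E_P[fun w => f (fd_vector (Y eps) u w)]%E) =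
    (fun eps => (\int[P]_w f (fd_vector (Y eps) u w))%:E).
  apply/funext => eps; apply: fin => j; under eq_fun do rewrite mxE.
  exact: (H2 _ (HY eps (u j))).1.
apply: cvg_EFin; first exact: nearW.
apply: lim => b th.
have sumE (Z : 'rV[R]_n -> Omega -> R) w : \sum_i b ord0 i * fd_vector Z u w ord0 i =
    \sum_(p <- [seq (b ord0 i, u i) | i <- index_enum 'I_k]) p.1 * Z p.2 w.
  by rewrite big_map; apply: eq_bigr => i _; rewrite mxE.
under eq_Rintegral do rewrite sumE.
have -> : (fun eps => \int[P]_w cos (\sum_i b ord0 i * fd_vector (Y eps) u w ord0 i + th)) =
    (fun eps => \int[P]_w cos (\sum_(p <- [seq (b ord0 i, u i) | i <- index_enum 'I_k])
      p.1 * Y eps p.2 w + th)).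
  by apply/funext => eps; under eq_Rintegral do rewrite sumE.
set sq := [seq _ | i <- _].
have HU eps : H (fun w => \sum_(p <- sq) p.1 * Y eps p.2 w).
  exact: (gaussian_space_sum _ (fun p => p.1) gH (fun p => HY eps p.2)).
have sY eps p : square_integrable P (Y eps p) by exact/H2/HY.
have E eps := covar_sum sq sq (fun p => p.1) (fun p => p.1)
  (fun p => sY eps p.2) (fun p => sY eps p.2).
have Uv : covar P (fun w => \sum_(p <- sq) p.1 * Y eps p.2 w)
    (fun w => \sum_(p <- sq) p.1 * Y eps p.2 w) @[eps --> 0^'+] --> quad_form K sq.
  rewrite (funext E); apply: cvg_sum => p; apply: cvg_sum => q; apply: cvgMr.
  exact: YK.
have mW := kernel_field_measurable sq kT.
exact: (cvg_integral_cos_gaussian (th := th) gH Hxi xi1 HU Uv mW (law sq)).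
Qed.

Lemma kernel_field_stationary_increments (R : realType) (n : nat) d
    (Omega : measurableType d) (P : probability Omega R) (H : set (Omega -> R))
    (K : 'rV[R]_n -> 'rV[R]_n -> R) (xi : Omega -> R) (T : 'rV[R]_n -> {RV P >-> R}) :
  gaussian_space P H -> psd_kernel K ->
  kernel_field P H K xi (fun u => T u : Omega -> R) ->
  (forall h u v : 'rV[R]_n, K (u + h) (v + h) - K (u + h) h - K h (v + h) + K h h =
                 K u v - K u 0 - K 0 v + K 0 0) ->
  stationary_increments T.
Proof.
move=> gH Kp kT Kh h k u; have [_ Hxi _ law] := kT; have [_ _ H2 _ _] := gH.
pose Z (g v : 'rV[R]_n) w := T (v + g) w - T g w.
have sT v := kernel_field_square_integrable v gH kT.
have sZ g v : square_integrable P (Z g v) by exact: square_integrable_sub.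
pose c j := \int[P]_w (Z h (u j) w ^+ 2) + \int[P]_w (Z 0 (u j) w ^+ 2) + 1.
have z0 (g : 'rV[R]_n) j : 0 <= \int[P]_w (Z g (u j) w ^+ 2).
  by apply: Rintegral_ge0 => w _; exact: sqr_ge0.
have c1 j : 1 <= c j by rewrite lerDr addr_ge0.
have lZ g : g = h \/ g = 0 -> l1_bounded P (\sum_j c j) (fd_vector (Z g) u).
  move=> hg; apply: l1_bounded_of_sqr => // j.
  by have := z0 h j; have := z0 0 j; case: hg => ->; rewrite /c; lra.
(* Encodes sum_i b_i (T (u_i + g) - T g) as a combination of values of T; the cases g = h and g = 0
   are compared. *)
pose s (g : 'rV[R]_n) (b : 'rV[R]_k) := [seq (b ord0 i, u i + g) | i <- index_enum 'I_k] ++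
  [seq (- b ord0 i, g) | i <- index_enum 'I_k].
have sumE (g : 'rV[R]_n) (b : 'rV[R]_k) w : \sum_i b ord0 i * fd_vector (Z g) u w ord0 i =
    \sum_(p <- s g b) p.1 * T p.2 w.
  rewrite /s big_cat/= !big_map -big_split/=; apply: eq_bigr => i _.
  by rewrite mxE /Z; ring.
have quadE (g : 'rV[R]_n) (b : 'rV[R]_k) : quad_form K (s g b) = \sum_i \sum_j b ord0 i * b ord0 j *
    (K (u i + g) (u j + g) - K (u i + g) g - K g (u j + g) + K g g).
  rewrite /quad_form /s big_cat/= !big_map -big_split/=; apply: eq_bigr => i _.
  rewrite !big_cat/= !big_map -!big_split/=; apply: eq_bigr => j _; ring.
have eZ : forall A, <<s [set B : set 'rV[R]_k | open B] >> A ->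
    P (fd_vector (Z h) u @^-1` A) = P (fd_vector (Z 0) u @^-1` A).
  apply: (eq_probability_of_cos (lZ h (or_introl erefl)) (lZ 0 (or_intror erefl))).
  move=> b th.
  under eq_Rintegral do rewrite sumE; under [RHS]eq_Rintegral do rewrite sumE.
  have mcos : measurable_fun setT (fun x : R => cos (x + th)).
    apply: (measurableT_comp (continuous_measurable_fun (@continuous_cos R))).
    exact: measurable_funD.
  have mxi a : measurable_fun setT (fun w => a * xi w).
    by apply: measurable_funM => //; exact: (H2 _ Hxi).1.
  rewrite (eq_law_Rintegral (kernel_field_measurable _ kT) (mxi _) (law _) mcos).
  rewrite (eq_law_Rintegral (kernel_field_measurable _ kT) (mxi _) (law _) mcos).
  suff -> : quad_form K (s h b) = quad_form K (s 0 b) by [].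
  rewrite !quadE; apply: eq_bigr => i _; apply: eq_bigr => j _; congr (_ * _).
  by rewrite Kh !addr0.
move=> A sA; rewrite eZ//; congr (P (_ @^-1` A)).
by apply/funext => w; apply/rowP => i; rewrite !mxE /Z addr0.
Qed.

Theorem proposition4p2 (R : realType) (n : nat) (hn : (0 < n)%N)
    (alpha beta : 'I_n -> R)
    (halpha : forall i, 0 < alpha i <= 2)
    (hbeta : forall i, 0 < beta i)
    (m : nat) (hm : (1 <= m <= n)%N)
    (halpha_eq : forall i j : 'I_n, (i < m)%N -> (j < m)%N ->
       alpha i = alpha j)
    (halpha_lt : forall i j : 'I_n, i.+1 = m -> nat_of_ord j = m ->
       alpha i < alpha j)
    (halpha_le : forall i j : 'I_n, (m <= i)%N -> (i <= j)%N ->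
       alpha i <= alpha j)
    (d : measure_display) (Omega : measurableType d) (P : probability Omega R)
    (X : 'rV[R]_n -> {RV P >-> R}) (hX : gsgcc alpha beta X) :
  exists (d' : measure_display) (Omega' : measurableType d')
         (P' : probability Omega' R) (T : 'rV[R]_n -> {RV P' >-> R}),
    [/\ lass_with_tangent X T,
        centered_gaussian_field T,
        stationary_increments T &
        forall u v : 'rV[R]_n,
          'E_P'[fun w => (T u w * T v w)%R]%E =
          (\sum_(i < n | (i < m)%N)
             beta i * (`|u ord0 i| `^ min_coord hn alpha
                       + `|v ord0 i| `^ min_coord hn alpha
                       - `|u ord0 i - v ord0 i| `^ min_coord hn alpha))%:E].
Proof.
have al0 i : 0 < alpha i by case/andP: (halpha i).
have [m0 mn] := andP hm; pose i0 := Ordinal hn.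
(* Ordinals start at 0: the minimal exponents sit at positions below m, and the strict jump is
   between positions m - 1 and m. *)
have al_lt (i : 'I_n) : (m <= i)%N -> alpha i0 < alpha i.
  move=> mi; have mn' : (m < n)%N := leq_ltn_trans mi (ltn_ord i).
  have pn : (m.-1 < n)%N by exact: leq_ltn_trans (leq_pred m) mn'.
  rewrite (halpha_eq i0 (Ordinal pn))//=; last by rewrite prednK.
  apply: lt_le_trans (halpha_le (Ordinal mn') i (leqnn m) mi).
  by apply: halpha_lt => //=; rewrite prednK.
have al_eq (i : 'I_n) : (i < m)%N -> alpha i0 = alpha i by move=> im; exact: halpha_eq.
have al_le i : alpha i0 <= alpha i.
  by have [/al_eq ->//|/al_lt/ltW] := ltnP i m.
pose a := min_coord hn alpha.
have aE : a = alpha i0.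
  apply/eqP; rewrite eq_le; apply/andP; split; first exact: bigmin_le_id.
  by rewrite /a /min_coord; elim/big_ind: _ => // x y hx hy; rewrite le_min hx.
have aal i : a <= alpha i by rewrite aE.
have a0 : 0 < a by rewrite aE.
(* Translates the selection by exponent in [cauchy_variogram] into the index range of the stated
   sum. *)
have alE i : (alpha i == a) = (i < m)%N.
  rewrite aE; have [/al_eq ->|/al_lt h] := ltnP i m; first by rewrite eqxx.
  by rewrite gt_eqF.
have gH := gsgcc_gaussian_space hX.
have eH := gsgcc_escaping i0 al0 hbeta hX.
have Kp := psd_tangent_kernel a0 aal hbeta hX.
have [q hq] := tangent_kernel_separable a al0 hbeta.
have [T0 [xi kT0]] := gaussian_field_of_kernel gH eH Kp hq.
have mT0 u : measurable_fun setT (T0 u).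
  by apply/measurable_EFinP; case: kT0 => /(_ u) /(measurable_int P).
pose T u : {RV P >-> R} := mfun_Sub (mem_set (mT0 u)).
have kT : kernel_field P (field_span (fun t => X t : Omega -> R))
  (tangent_kernel alpha beta a) xi (fun u => T u : Omega -> R) := kT0.
have covT u v : covar P (T u) (T v) = tangent_kernel alpha beta a u v.
  exact: (kernel_field_covar _ _ gH Kp kT).
exists d, Omega, P, T; split.
- exists (a / 2) => t0; split.
    apply: (kernel_field_cvg_fdd gH Kp kT (Y := rescaled_increment X t0 (a / 2))).
      by move=> eps u; rewrite rescaled_increment_span; eexists.
    by move=> u v; exact: rescaled_increment_covar_cvg.
  (* Coordinate 0 belongs to the minimal block as m >= 1, so T u has variance 2 V(u) > 0 in this
     direction. *)
  pose u : 'rV[R]_n := delta_mx ord0 i0.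
  exists u => Tu0; have := covT u u.
  have -> : covar P (T u) (T u) = 0.
    rewrite covar_sqr /Rintegral (@ae_eq_integral _ _ _ P setT (cst 0%E))//.
    - by rewrite integral_cst// mul0e.
    - by apply/measurable_EFinP; exact: measurable_funX.
    - by apply: filterS Tu0 => w -> _; rewrite expr0n.
  rewrite /tangent_kernel subrr cauchy_variogram0// subr0 => /esym/eqP; apply/negP.
  rewrite gt_eqF// -mulr2n pmulrn_lgt0// /cauchy_variogram (bigD1 i0)//=.
  rewrite ltr_pwDl//; last first.
    by apply: sumr_ge0 => i _; rewrite !mulr_ge0 ?powR_ge0 ?(ltW (hbeta i))//.
  by rewrite mxE !eqxx normr1 powR1 mulr1 alE m0 mulr1.
- exact: (kernel_field_gaussian gH kT).
- apply: (kernel_field_stationary_increments gH Kp kT) => h u v.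
  have e1 : u + h - (v + h) = u - v by rewrite opprD addrACA subrr addr0.
  have e2 : h - (v + h) = - v by rewrite opprD addrCA subrr addr0.
  rewrite /tangent_kernel e1 e2 (addrK h u) (subrr h) (subr0 u) (sub0r v).
  rewrite (subrr (0 : 'rV[R]_n)); move: (cauchy_variogram alpha beta a) => V; ring.
- move=> u v; have sT w := kernel_field_square_integrable w gH kT.
  have fin : (\int[P]_w (T u w * T v w)%:E)%E \is a fin_num.
    apply: integrable_fin_num => //; exact: (square_integrableM (sT u) (sT v)).
  rewrite unlock (etrans (esym (fineK fin)) (f_equal EFin (covT u v))); congr EFin.
  rewrite /tangent_kernel /cauchy_variogram -big_split -sumrB [RHS]big_mkcond.
  apply: eq_bigr => i _; rewrite /= alE !mxE; case: ifP => im; last by rewrite !mulr0 addr0 subr0.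
  by rewrite -/a aE (al_eq i im) !mulr1 mulrBr mulrDr.
Qed.
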